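(* Let $u_1,\dots,u_4$ be a positive orthonormal basis of an oriented Euclidean four-space $\mathcal{T}$. Given $\mathrm{s},\lambda,\mu,c_2,c_3,c_4\in\mathbb{R}$ with $c_2+c_3+c_4=0$ and $\lambda>\mu\ge0$, let $R$ be the algebraic curvature tensor in $\mathcal{T}$ with scalar curvature $\mathrm{s}$, with Einstein tensor $\mathrm{e}$ diagonalized by $u_1,u_2,u_3,u_4$ with the respective eigenvalues $(\mu_1,\mu_2,\mu_3,\mu_4)=(-\lambda,-\mu,\mu,\lambda)$, and such that, for each sign $\pm$, $W^\pm:\Lambda^\pm\to\Lambda^\pm$ is diagonalized by the basis $u_1\wedge u_2\pm u_3\wedge u_4,\ u_1\wedge u_3\pm u_4\wedge u_2,\ u_1\wedge u_4\pm u_2\wedge u_3$ of $\Lambda^\pm$ with the respective eigenvalues $\pm c_2-\mathrm{s}/12,\ \pm c_3-\mathrm{s}/12,\ \pm c_4+\mathrm{s}/6$. Then: (a) $R$ is weakly Einstein. (b) The only possibly-nonzero components of $W$ in the frame $u_1,\dots,u_4$ are those algebraically related to the ones occurring in the ordered triples $(W_{1212},W_{1313},W_{1414})=(W_{3434},W_{2424},W_{2323})=(-\mathrm{s}/12,-\mathrm{s}/12,\mathrm{s}/6)$ and $(W_{1234},W_{1342},W_{1423})=(c_2,c_3,c_4)$. (c) For every non-Einstein, weakly Einstein algebraic curvature tensor in an oriented Euclidean four-space, with scalar curvature $\mathrm{s}\ne0$, except when its Einstein tensor $\mathrm{e}$ has two double eigenvalues (that is, two distinct eigenvalues, each of multiplicity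 two), there exist a positive orthonormal basis $u_1,\dots,u_4$ of the four-space and $\lambda,\mu,c_2,c_3,c_4\in\mathbb{R}$ with $c_2+c_3+c_4=0$ and $\lambda>\mu\ge0$ such that its Einstein tensor $\mathrm{e}$ is diagonalized by $u_1,u_2,u_3,u_4$ with the respective eigenvalues $-\lambda,-\mu,\mu,\lambda$ and, for each sign $\pm$, its $W^\pm:\Lambda^\pm\to\Lambda^\pm$ is diagonalized by the basis $u_1\wedge u_2\pm u_3\wedge u_4,\ u_1\wedge u_3\pm u_4\wedge u_2,\ u_1\wedge u_4\pm u_2\wedge u_3$ of $\Lambda^\pm$ with the respective eigenvalues $\pm c_2-\mathrm{s}/12,\ \pm c_3-\mathrm{s}/12,\ \pm c_4+\mathrm{s}/6$.
   Context: $\mathcal{T}$ is an oriented Euclidean four-space with inner product $\mathrm{g}$. An algebraic curvature tensor $R$ in $\mathcal{T}$ is a $(0,4)$ tensor with $R_{ijkl}=-R_{jikl}=-R_{ijlk}=R_{klij}$ and $R_{ijkl}+R_{jkil}+R_{kijl}=0$. In an orthonormal basis, the Ricci tensor is $\mathrm{r}_{ij}=\sum_k R_{ikjk}$, the scalar curvature is $\mathrm{s}=\sum_i \mathrm{r}_{ii}$, the Einstein (traceless Ricci) tensor is $\mathrm{e}=\mathrm{r}-\mathrm{s}\,\mathrm{g}/4$, and the Weyl component is $W_{ijkl}=R_{ijkl}-\frac12(\mathrm{g}_{ik}\mathrm{r}_{jl}+\mathrm{g}_{jl}\mathrm{r}_{ik}-\mathrm{g}_{il}\mathrm{r}_{jk}-\mathrm{g}_{jk}\mathrm{r}_{il})+\frac{\mathrm{s}}6(\mathrm{g}_{ik}\mathrm{g}_{jl}-\mathrm{g}_{il}\mathrm{g}_{jk})$.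 $R$ is called weakly Einstein if the symmetric tensor with components $\sum_{k,p,q}R_{ikpq}R_{jkpq}$ (in an orthonormal basis) is a multiple of $\mathrm{g}$, and Einstein if $\mathrm{e}=0$. Eigenvalues of $\mathrm{e}$ are taken relative to $\mathrm{g}$. $\Lambda^\pm\subset\mathcal{T}^{\wedge2}$ are the three-dimensional spaces of self-dual and anti-self-dual bivectors; $W$ acts on bivectors $b$ by $[Wb]_{ij}=\sum_{p,q}W_{ipjq}b_{pq}=\frac12\sum_{p,q}W_{ijpq}b_{pq}$, this action preserves $\Lambda^\pm$, and $W^\pm:\Lambda^\pm\to\Lambda^\pm$ denote its restrictions. By the Singer-Thorpe theorem, prescribing $\mathrm{s}\in\mathbb{R}$, a $\mathrm{g}$-traceless symmetric tensor $\mathrm{e}$ and traceless self-adjoint $W^\pm:\Lambda^\pm\to\Lambda^\pm$ defines a unique algebraic curvature tensor $R$. Components of $W$ ''algebraically related'' to given ones are those obtained from them via the symmetries $W_{ijkl}=-W_{jikl}=-W_{ijlk}=W_{klij}$. *)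

(* Defs.v *)
From HB Require Import structures.
From mathcomp Require Import all_boot all_order all_algebra reals.

Set Implicit Arguments.
Unset Strict Implicit.
Unset Printing Implicit Defensive.

Import Order.TTheory GRing.Theory Num.Theory.
Local Open Scope ring_scope.

(* The orientation, a class of ordered bases, is given by a representative,
   which need not be orthonormal. *)
Record oriented_euclidean4 (K : realType) := OrientedEuclidean4 {
  carrier :> vectType K;
  inner : {dot carrier for idfun};
  orientation : 4.-tuple carrier;
  orientationP : basis_of {:carrier} orientation }.

(* Indices 1, ..., 4. *)
Definition i1 : 'I_4 := @Ordinal 4 0 isT.
Definition i2 : 'I_4 := @Ordinal 4 1 isT.
Definition i3 : 'I_4 := @Ordinal 4 2 isT.
Definition i4 : 'I_4 := @Ordinal 4 3 isT.

Section Frames.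
Variables (K : realType) (T : oriented_euclidean4 K).
Local Notation g := (inner T).
Implicit Types u : 'I_4 -> T.

Definition orthonormal_basis u : bool :=
  [forall i, forall j, g (u i) (u j) == (i == j)%:R].

Definition positive_basis u : bool :=
  0 < \det (\matrix_(i, j) coord (orientation T) j (u i)).

Definition positive_orthonormal_basis u : bool :=
  orthonormal_basis u && positive_basis u.

Lemma orthonormal_basisP u :
  reflect (forall i j, g (u i) (u j) = (i == j)%:R) (orthonormal_basis u).
Proof.
apply: (iffP forallP) => [H i j|H i]; first by have /forallP/(_ j)/eqP := H i.
by apply/forallP => j; apply/eqP.
Qed.

Lemma inner_comb u (r : 'I_4 -> K) j :
  orthonormal_basis u -> g (\sum_i r i *: u i) (u j) = r j.
Proof.
move=> /orthonormal_basisP ou; rewrite linear_sumlz (bigD1 j) //= linearZl_LR /=.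
rewrite ou eqxx mulr1 big1 ?addr0 // => i /negPf ij.
by rewrite linearZl_LR /= ou ij mulr0.
Qed.

Lemma gram_schmidt n : (n <= 4)%N ->
  exists s : seq T, [/\ size s = n, uniq s &
    {in s &, forall x y, g x y = (x == y)%:R}].
Proof.
elim: n => [|n IHn] lt_n4; first by exists [::].
have [s [sz_s us os]] := IHn (ltnW lt_n4).
have /subvPn[v _ vs] : ~~ ({:T} <= <<s>>)%VS.
  apply: contraL lt_n4 => /dimvS; rewrite -(size_basis (orientationP T)).
  by move=> /leq_trans/(_ (dim_span s)); rewrite sz_s -leqNgt.
pose w := v - \sum_(x <- s) g v x *: x.
have w0 : w != 0.
  apply: contraNneq vs => /eqP; rewrite subr_eq0 => /eqP ->.
  by rewrite big_seq; apply: memv_suml => x xs; rewrite memvZ // memv_span.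
have wo y : y \in s -> g w y = 0.
  move=> ys; rewrite linearBl linear_sumlz (big_rem y) //= linearZl_LR /=.
  rewrite (os _ _ ys ys) eqxx mulr1 big_seq big1 ?addr0 ?subrr // => x xs.
  rewrite linearZl_LR /= (os _ _ (mem_rem xs) ys).
  by case: eqP xs => [->|]; rewrite ?mem_rem_uniqF ?mulr0.
have ww : 0 < g w w by apply: neq0_dnorm_gt0.
pose z := (Num.sqrt (g w w))^-1 *: w.
have zz : g z z = 1.
  rewrite linearZl_LR linearZr_LR /= mulrA -expr2 exprVn sqr_sqrtr ?ltW //.
  by rewrite mulVf // gt_eqF.
have zo y : y \in s -> g z y = 0.
  by move=> ys; rewrite linearZl_LR /= (wo _ ys) mulr0.
have zs : z \notin s.
  by apply/negP => /zo; rewrite zz => /eqP; rewrite oner_eq0.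
have gC x y : g x y = g y x by rewrite hermC expr0 mul1r.
exists (z :: s); split; rewrite /= ?sz_s ?zs //.
move=> x y; rewrite !inE => /orP[/eqP->|xs] /orP[/eqP->|ys].
- by rewrite eqxx zz.
- by rewrite zo //; case: eqP ys zs => // -> ->.
- by rewrite gC zo //; case: eqP xs zs => // -> ->.
- exact: os.
Qed.

Lemma orthonormal_det_neq0 u : orthonormal_basis u ->
  \det (\matrix_(i, j) coord (orientation T) j (u i)) != 0.
Proof.
move=> ou; apply/negP => /det0P[r r0 rA]; case/eqP: r0; apply/rowP => j.
rewrite mxE -(inner_comb (r 0) j ou).
suff -> : \sum_i r 0 i *: u i = 0 by rewrite linear0l.
rewrite (coord_basis (orientationP T) (memvf (\sum_i r 0 i *: u i))).
apply: big1 => k _; rewrite linear_sum /=.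
move/rowP/(_ k): rA; rewrite !mxE => rA.
rewrite (_ : \sum_i _ = 0) ?scale0r // -[RHS]rA.
by apply: eq_bigr => i _; rewrite linearZ /= mxE.
Qed.

Lemma orthonormal_expansion u x :
  orthonormal_basis u -> x = \sum_i g x (u i) *: u i.
Proof.
move=> ou; pose s := [tuple u i | i < 4].
have fs : free s.
  apply/freeP => k; under eq_bigr do rewrite -tnth_nth tnth_mktuple.
  by move=> k0 i; rewrite -(inner_comb k i ou) k0 linear0l.
have sT : basis_of {:T} s.
  rewrite basisEfree fs subvf size_tuple.
  by rewrite (size_basis (orientationP T)).
rewrite {1}(coord_basis sT (memvf x)); apply: eq_bigr => i _.
rewrite -tnth_nth tnth_mktuple; congr (_ *: _).
rewrite [in RHS](coord_basis sT (memvf x)).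
under [in RHS]eq_bigr do rewrite -tnth_nth tnth_mktuple.
by rewrite inner_comb.
Qed.

Lemma orthonormal_parseval u x y : orthonormal_basis u ->
  g x y = \sum_i g x (u i) * g y (u i).
Proof.
move=> ou; rewrite {1}(orthonormal_expansion y ou) linear_sumr.
by apply: eq_bigr => i _; rewrite linearZr_LR /= mulrC.
Qed.

Lemma exists_positive_orthonormal_basis :
  exists u : {ffun 'I_4 -> T}, positive_orthonormal_basis u.
Proof.
have [s [sz_s us os]] := gram_schmidt (leqnn 4).
pose u (i : 'I_4) := nth 0 s i.
have ou : orthonormal_basis u.
  apply/orthonormal_basisP => i j.
  by rewrite os ?mem_nth ?sz_s // nth_uniq ?sz_s.
have := orthonormal_det_neq0 ou; rewrite neq_lt => /orP[] du; last first.
  exists (finfun u); apply/andP; split.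
    by apply/orthonormal_basisP => i j; rewrite !ffunE; apply/orthonormal_basisP.
  rewrite /positive_basis; congr (_ < \det _): du.
  by apply/matrixP => i j; rewrite !mxE ffunE.
pose d : 'rV[K]_4 := \row_i (-1) ^+ (i == i1).
exists [ffun i => d 0 i *: u i]; apply/andP; split.
  apply/orthonormal_basisP => i j; rewrite !ffunE linearZl_LR linearZr_LR /=.
  rewrite (orthonormal_basisP _ ou); case: eqP => [->|]; last by rewrite !mulr0.
  by rewrite mulr1 !mxE -signr_addb addbb.
rewrite /positive_basis.
set A := \matrix_(i, j) _ in du; set B := \matrix_(i, j) _.
have -> : B = diag_mx d *m A.
  by apply/matrixP => i j; rewrite mul_diag_mx !mxE ffunE linearZ /= mxE.
rewrite det_mulmx det_diag big_ord_recl big1 => [|i _]; last by rewrite mxE.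
by rewrite mxE expr1 mulr1 mulN1r oppr_gt0.
Qed.

(* A positive orthonormal basis chosen to compute contractions and the volume
   form; [contraction_frame] and [volume_frame] show that the choice is
   immaterial. *)
Definition frame : {ffun 'I_4 -> T} := xchoose exists_positive_orthonormal_basis.

Lemma frameP : positive_orthonormal_basis frame.
Proof. exact: (xchooseP exists_positive_orthonormal_basis). Qed.

End Frames.

Section CurvatureTensors.
Variables (K : realType) (T : oriented_euclidean4 K).
Local Notation g := (inner T).
Local Notation f := (frame T).

Definition tensor2 : Type := T -> T -> K.
Definition tensor4 : Type := T -> T -> T -> T -> K.
Implicit Types (B b : tensor2) (R W : tensor4) (u : 'I_4 -> T).

Definition curvature_tensor R : Prop :=
  (forall y z w, scalar (fun x => R x y z w)) /\
  (forall x z w, scalar (fun y => R x y z w)) /\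
  (forall x y w, scalar (fun z => R x y z w)) /\
  (forall x y z, scalar (fun w => R x y z w)) /\
  (forall x y z w, R x y z w = - R y x z w) /\
  (forall x y z w, R x y z w = - R x y w z) /\
  (forall x y z w, R x y z w = R z w x y) /\
  (forall x y z w, R x y z w + R y z x w + R z x y w = 0).

Definition ricci R : tensor2 := fun x y => \sum_k R x (f k) y (f k).

Definition scalar_curvature R : K := \sum_i ricci R (f i) (f i).

Definition einstein_tensor R : tensor2 :=
  fun x y => ricci R x y - scalar_curvature R * g x y / 4.

Definition weyl R : tensor4 := fun x y z w =>
  R x y z w
  - 2^-1 * (g x z * ricci R y w + g y w * ricci R x z
            - g x w * ricci R y z - g y z * ricci R x w)
  + scalar_curvature R / 6 * (g x z * g y w - g x w * g y z).

Definition einstein R : Prop := forall x y, einstein_tensor R x y = 0.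

Definition weakly_einstein R : Prop :=
  exists c : K, forall x y,
    \sum_k \sum_p \sum_q R x (f k) (f p) (f q) * R y (f k) (f p) (f q)
    = c * g x y.

(* The endomorphism that corresponds to a bilinear form via the inner product;
   eigenvalues of the form are those of this endomorphism. *)
Definition sharp B : 'End(T) := linfun (fun x : T => \sum_k B x (f k) *: f k).

Definition multiplicity B (a : K) : nat :=
  \dim (passmx.leigenspace (sharp B) a).

Definition two_double_eigenvalues B : Prop :=
  exists a a' : K,
    [/\ a != a', multiplicity B a = 2%N & multiplicity B a' = 2%N].

Definition diagonalizes B u (m : 'I_4 -> K) : Prop :=
  forall i, sharp B (u i) = m i *: u i.

(* Bivectors are skew-symmetric tensors, with indices lowered by the inner
   product. *)
Definition bivector b : Prop :=
  (forall x, scalar (b x)) /\ (forall x y, b x y = - b y x).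

Definition wedge (x y : T) : tensor2 :=
  fun z w => g x z * g y w - g x w * g y z.

Definition volume (x y z w : T) : K :=
  \det (\matrix_(i < 4, j < 4) g (tnth [tuple x; y; z; w] i) (f j)).

Definition hodge b : tensor2 := fun x y =>
  2^-1 * \sum_k \sum_l volume x y (f k) (f l) * b (f k) (f l).

(* Lambda^+ for [eps = 1] and Lambda^- for [eps = -1]. *)
Definition Lambda (eps : K) b : Prop :=
  bivector b /\ forall x y, hodge b x y = eps * b x y.

Definition basis_of_Lambda (eps : K) (b : 'I_3 -> tensor2) : Prop :=
  (forall j, Lambda eps (b j)) /\
  forall c, Lambda eps c ->
    exists! a : 'rV[K]_3, forall x y, c x y = \sum_j a 0 j * b j x y.

Definition act W b : tensor2 :=
  fun x y => \sum_p \sum_q W x (f p) y (f q) * b (f p) (f q).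

(* The basis [b] of Lambda^eps diagonalizes the restriction of [W] to
   Lambda^eps, with the eigenvalues [k]. *)
Definition diagonalizes_on_Lambda
    (eps : K) W (b : 'I_3 -> tensor2) (k : 'I_3 -> K) : Prop :=
  basis_of_Lambda eps b /\ forall j x y, act W (b j) x y = k j * b j x y.

Definition Lambda_basis u (eps : K) : 'I_3 -> tensor2 :=
  tnth [tuple
    (fun x y => wedge (u i1) (u i2) x y + eps * wedge (u i3) (u i4) x y);
    (fun x y => wedge (u i1) (u i3) x y + eps * wedge (u i4) (u i2) x y);
    (fun x y => wedge (u i1) (u i4) x y + eps * wedge (u i2) (u i3) x y)].

Definition prescribed_form R u (s lam mu c2 c3 c4 : K) : Prop :=
  diagonalizes (einstein_tensor R) u (tnth [tuple - lam; - mu; mu; lam]) /\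
  forall sg : bool, let eps : K := (-1) ^+ sg in
    diagonalizes_on_Lambda eps (weyl R) (Lambda_basis u eps)
      (tnth [tuple eps * c2 - s / 12; eps * c3 - s / 12; eps * c4 + s / 6]).

(* A bilinear form, such as a partial contraction of a tensor, has the same
   trace in every orthonormal basis. *)
Lemma contraction_frame B u :
  (forall y, scalar (fun x => B x y)) -> (forall x, scalar (B x)) ->
  orthonormal_basis u -> \sum_k B (f k) (f k) = \sum_k B (u k) (u k).
Proof.
move=> Bl Br ou; have /andP[of_ _] := frameP T.
pose Lr x : {scalar T} := HB.pack (B x) (GRing.isLinear.Build _ _ _ _ _ (Br x)).
pose Ll y : {scalar T} :=
  HB.pack (B^~ y) (GRing.isLinear.Build _ _ _ _ _ (Bl y)).
have Bsumr x (c : 'I_4 -> K) : B x (\sum_i c i *: u i) = \sum_i c i * B x (u i).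
  rewrite -[LHS]/(Lr x _) linear_sum.
  by apply: eq_bigr => i _; rewrite linearZ.
have Bsuml y (c : 'I_4 -> K) : B (\sum_i c i *: u i) y = \sum_i c i * B (u i) y.
  rewrite -[LHS]/(Ll y _) linear_sum.
  by apply: eq_bigr => i _; rewrite linearZ.
transitivity (\sum_i \sum_j g (u i) (u j) * B (u i) (u j)); last first.
  apply: eq_bigr => i _; rewrite (bigD1 i) //= big1 => [|j /negPf ji].
    by rewrite (orthonormal_basisP _ ou) eqxx mul1r addr0.
  by rewrite (orthonormal_basisP _ ou) eq_sym ji mul0r.
transitivity
  (\sum_k \sum_i \sum_j g (f k) (u i) * g (f k) (u j) * B (u i) (u j)).
  apply: eq_bigr => k _.
  rewrite [in LHS](orthonormal_expansion (f k) ou) Bsuml; apply: eq_bigr => i _.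
  by rewrite Bsumr mulr_sumr; apply: eq_bigr => j _; rewrite mulrA.
rewrite exchange_big; apply: eq_bigr => i _.
rewrite exchange_big; apply: eq_bigr => j _.
rewrite -mulr_suml (orthonormal_parseval (u i) (u j) of_); congr (_ * _).
have gC x y : g x y = g y x by rewrite hermC expr0 mul1r.
by apply: eq_bigr => k _; rewrite (gC (u i)) (gC (u j)).
Qed.

Lemma inner_sharp B x y :
  (forall y, scalar (fun x => B x y)) -> (forall x, scalar (B x)) ->
  g (sharp B x) y = B x y.
Proof.
move=> Bl Br; have /andP[of_ _] := frameP T.
have lin : linear (fun x : T => \sum_k B x (f k) *: f k).
  move=> a v w; rewrite scaler_sumr -big_split; apply: eq_bigr => k _.
  by rewrite (Bl (f k)) scalerDl scalerA.
pose L : {linear T -> T} :=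
  HB.pack (fun x : T => \sum_k B x (f k) *: f k)
          (GRing.isLinear.Build _ _ _ _ _ lin).
pose Lr : {scalar T} := HB.pack (B x) (GRing.isLinear.Build _ _ _ _ _ (Br x)).
rewrite -[sharp B]/(linfun L) lfunE /= linear_sumlz.
rewrite {2}(orthonormal_expansion y of_) -[RHS]/(Lr _) linear_sum.
apply: eq_bigr => k _; rewrite linearZl_LR linearZ /= mulrC.
by congr (_ * _); rewrite hermC expr0 mul1r.
Qed.

Lemma volume_frame u x y z w : positive_orthonormal_basis u ->
  volume x y z w =
  \det (\matrix_(i < 4, j < 4) g (tnth [tuple x; y; z; w] i) (u j)).
Proof.
move=> /andP[ou pu]; have /andP[of_ pf] := frameP T; rewrite /volume.
pose P := \matrix_(i, j) g (u i) (f j).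
have -> : \matrix_(i < 4, j < 4) g (tnth [tuple x; y; z; w] i) (f j) =
          \matrix_(i < 4, j < 4) g (tnth [tuple x; y; z; w] i) (u j) *m P.
  apply/matrixP => i j; rewrite !mxE.
  rewrite {1}(orthonormal_expansion (tnth _ i) ou) linear_sumlz.
  by apply: eq_bigr => k _; rewrite linearZl_LR /= !mxE.
rewrite det_mulmx.
have PP : P *m P^T = 1%:M.
  apply/matrixP => i j; rewrite !mxE -(orthonormal_basisP _ ou).
  rewrite (orthonormal_parseval (u i) (u j) of_).
  by apply: eq_bigr => k _; rewrite !mxE.
have P0 : 0 < \det P.
  move: pu; rewrite /positive_basis.
  have -> : \matrix_(i, j) coord (orientation T) j (u i) =
            P *m \matrix_(i, j) coord (orientation T) j (f i).
    apply/matrixP => i j; rewrite !mxE {1}(orthonormal_expansion (u i) of_).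
    by rewrite linear_sum; apply: eq_bigr => k _; rewrite linearZ /= !mxE.
  by rewrite det_mulmx pmulr_lgt0.
suff -> : \det P = 1 by rewrite mulr1.
apply/eqP; rewrite -(@pexpr_eq1 _ _ 2) ?ltW // expr2 -{2}det_tr -det_mulmx PP.
by rewrite det1.
Qed.

End CurvatureTensors.

(* A quadruple of indices for a component of a (0,4) tensor. *)
Definition quad : Type := ('I_4 * 'I_4 * 'I_4 * 'I_4)%type.

(* Components related by W_ijkl = - W_jikl = - W_ijlk = W_klij. *)
Inductive alg_related (q : quad) : quad -> Prop :=
| alg_related_refl : alg_related q q
| alg_related_swap12 i j k l :
    alg_related q (i, j, k, l) -> alg_related q (j, i, k, l)
| alg_related_swap34 i j k l :
    alg_related q (i, j, k, l) -> alg_related q (i, j, l, k)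
| alg_related_swap_pairs i j k l :
    alg_related q (i, j, k, l) -> alg_related q (k, l, i, j).

Definition listed_components : seq quad :=
  [:: (i1, i2, i1, i2); (i1, i3, i1, i3); (i1, i4, i1, i4);
      (i3, i4, i3, i4); (i2, i4, i2, i4); (i2, i3, i2, i3);
      (i1, i2, i3, i4); (i1, i3, i4, i2); (i1, i4, i2, i3)].

(* Main.v *)
From HB Require Import structures.
Require Import Defs.
From mathcomp Require Import all_boot all_order all_algebra reals.
From mathcomp Require Import boolp classical_sets topology normedtype derive.
From mathcomp Require Import ring lra.
Import Order.TTheory GRing.Theory Num.Theory.
Import numFieldTopology.Exports numFieldNormedType.Exports.
Set Implicit Arguments.
Unset Strict Implicit.
Unset Printing Implicit Defensive.

(** Everything rests on one identity of dimension four.  Write [q_ij] for the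
components of the symmetric tensor whose being a multiple of [g] means that
[R] is weakly Einstein.  Decomposing [R] into its scalar, Einstein and Weyl
parts, the contributions to [q] that are quadratic in one of these parts are
multiples of [g] (for the Weyl part and for the Einstein part this is special
to dimension four), and what remains is

   [q_ij = c g_ij + 2 sum_pq W_ipjq e_pq + (s/3) e_ij].

So [R] is weakly Einstein if and only if [W e = - (s/6) e], where [W] acts on
symmetric tensors ([square_component_traceless], [weakly_einstein_diagP]).  In
an orthonormal eigenframe of [e], with eigenvalues [m_i], this is a system of
equations that involve one component of [W] each ([weyl_eigenframe]):
[(m_1 + m_j) (W_1j1j + s/12) = 0] and, for [i, j, k, l] distinct,
[(m_k - m_l) W_ikjk = 0].

On the other hand, by the Bianchi identity, [W] acts on the bivector
[v /\ w] by plugging [v] and [w] into its last two slots ([act_wedge]).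
Hence diagonality of [W] on both spaces of bivectors amounts to explicit values
of all components of [W] ([weyl_diagonal_form]), from which (b) is read off,
and (a) follows from [W e = - (s/6) e].

For (c), sort the eigenvalues of [e].  The three numbers [W_1j1j] add up to 0,
so [s <> 0] forces some [m_1 + m_j] to vanish.  As the eigenvalues are sorted
and have sum 0, and two double eigenvalues are excluded, this gives
[m = (- lam, - mu, mu, lam)] with [lam > mu >= 0]
([einstein_eigenvalues_opposite]).  The equations above then determine
[W_1212], [W_1313] and [W_1414], and kill the off-diagonal components, except
[W_1224] when [mu = 0].  In that case [u_2, u_3] may be rotated within the
kernel of [e]: the form [x, y |-> W (u_1, x, u_4, y)] is traceless on their
span, so it has an isotropic vector there, which serves as the new [u_2]
([exists_isotropic]).  Changing the sign of [u_1] adjusts the orientation.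

The sorted eigenframe itself maximizes [sum_i i B (u_i, u_i)] over the compact
set of orthonormal frames: comparing with rotated frames gives orthogonality
and order at once ([exists_sorted_eigenframe]). *)

Local Open Scope ring_scope.

(** * Components of curvature tensors in dimension four *)

Lemma I4_ind (P : 'I_4 -> Prop) : P i1 -> P i2 -> P i3 -> P i4 -> forall i, P i.
Proof.
move=> P1 P2 P3 P4 [[|[|[|[|//]]]] lti].
- by rewrite (_ : Ordinal lti = i1) //; apply: val_inj.
- by rewrite (_ : Ordinal lti = i2) //; apply: val_inj.
- by rewrite (_ : Ordinal lti = i3) //; apply: val_inj.
- by rewrite (_ : Ordinal lti = i4) //; apply: val_inj.
Qed.

Lemma sum_I4 (V : nmodType) (F : 'I_4 -> V) :
  \sum_i F i = F i1 + F i2 + F i3 + F i4.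
Proof.
rewrite !big_ord_recl big_ord0 addr0 !addrA.
by do ![congr (_ + _)]; congr F; apply: val_inj.
Qed.

Section Components.
Variables (K : realType) (r : 'I_4 -> 'I_4 -> 'I_4 -> 'I_4 -> K).

Definition curvature_components : Prop :=
  [/\ forall i j k l, r i j k l = - r j i k l,
      forall i j k l, r i j k l = - r i j l k,
      forall i j k l, r i j k l = r k l i j &
      forall i j k l, r i j k l + r j k i l + r k i j l = 0].

Hypothesis rP : curvature_components.

Lemma component_diag12 i k l : r i i k l = 0.
Proof. by case: rP => s12 _ _ _; have := s12 i i k l; lra. Qed.

Lemma component_diag34 i j k : r i j k k = 0.
Proof. by case: rP => _ s34 _ _; have := s34 i j k k; lra. Qed.

(** Rewriting with [canonical12], [canonical34], [canonical_pairs] and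
[canonical_bianchi] brings a component to a form with ascending index pairs in
lexicographic order, and leaves the 20 linearly independent components; thus
identities between components become polynomial identities. *)
Lemma canonical12 :
  (forall k l, r i2 i1 k l = - r i1 i2 k l) *
  (forall k l, r i3 i1 k l = - r i1 i3 k l) *
  (forall k l, r i4 i1 k l = - r i1 i4 k l) *
  (forall k l, r i3 i2 k l = - r i2 i3 k l) *
  (forall k l, r i4 i2 k l = - r i2 i4 k l) *
  (forall k l, r i4 i3 k l = - r i3 i4 k l).
Proof. by case: rP => s12 _ _ _; do !split => *; apply: s12. Qed.

Lemma canonical34 :
  (forall i j, r i j i2 i1 = - r i j i1 i2) *
  (forall i j, r i j i3 i1 = - r i j i1 i3) *
  (forall i j, r i j i4 i1 = - r i j i1 i4) *
  (forall i j, r i j i3 i2 = - r i j i2 i3) *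
  (forall i j, r i j i4 i2 = - r i j i2 i4) *
  (forall i j, r i j i4 i3 = - r i j i3 i4).
Proof. by case: rP => _ s34 _ _; do !split => *; apply: s34. Qed.

Lemma canonical_pairs :
  (r i1 i3 i1 i2 = r i1 i2 i1 i3) *
  (r i1 i4 i1 i2 = r i1 i2 i1 i4) *
  (r i2 i3 i1 i2 = r i1 i2 i2 i3) *
  (r i2 i4 i1 i2 = r i1 i2 i2 i4) *
  (r i3 i4 i1 i2 = r i1 i2 i3 i4) *
  (r i1 i4 i1 i3 = r i1 i3 i1 i4) *
  (r i2 i3 i1 i3 = r i1 i3 i2 i3) *
  (r i2 i4 i1 i3 = r i1 i3 i2 i4) *
  (r i3 i4 i1 i3 = r i1 i3 i3 i4) *
  (r i2 i3 i1 i4 = r i1 i4 i2 i3) *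
  (r i2 i4 i1 i4 = r i1 i4 i2 i4) *
  (r i3 i4 i1 i4 = r i1 i4 i3 i4) *
  (r i2 i4 i2 i3 = r i2 i3 i2 i4) *
  (r i3 i4 i2 i3 = r i2 i3 i3 i4) *
  (r i3 i4 i2 i4 = r i2 i4 i3 i4).
Proof. by case: rP => _ _ sp _; do !split; apply: sp. Qed.

(** Up to the other symmetries, the Bianchi identity is void unless its indices
are distinct, and then this is all it says. *)
Lemma canonical_bianchi : r i1 i4 i2 i3 = r i1 i3 i2 i4 - r i1 i2 i3 i4.
Proof.
case: rP => s12 s34 sp b; have := b i1 i2 i3 i4.
rewrite (sp i2 i3) (s12 i3 i1); lra.
Qed.

Definition canonical :=
  (component_diag12, component_diag34, canonical12, canonical34,
   canonical_pairs, canonical_bianchi).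

Hypothesis tr0 : forall i j, \sum_k r i k j k = 0.

(** Trace-freeness makes the tensor, as an operator on bivectors, commute with the
Hodge star, so that complementary index pairs may be exchanged; with the relation
between the diagonal components, 10 independent components remain. *)
Lemma weyl_canonical :
  (r i2 i3 i3 i4 = r i1 i2 i1 i4) *
  (r i2 i4 i3 i4 = - r i1 i2 i1 i3) *
  (r i2 i3 i2 i4 = - r i1 i3 i1 i4) *
  (r i1 i3 i3 i4 = - r i1 i2 i2 i4) *
  (r i1 i4 i3 i4 = r i1 i2 i2 i3) *
  (r i1 i4 i2 i4 = - r i1 i3 i2 i3) *
  (r i3 i4 i3 i4 = r i1 i2 i1 i2) *
  (r i2 i4 i2 i4 = r i1 i3 i1 i3) *
  (r i2 i3 i2 i3 = r i1 i4 i1 i4) *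
  (r i1 i4 i1 i4 = - r i1 i2 i1 i2 - r i1 i3 i1 i3).
Proof.
have := (tr0 i2 i4, tr0 i2 i3, tr0 i3 i4, tr0 i1 i4, tr0 i1 i3, tr0 i1 i2,
  tr0 i1 i1, tr0 i2 i2, tr0 i3 i3, tr0 i4 i4).
rewrite !sum_I4 !canonical => -[[[[[[[[[]]]]]]]]].
move=> *; do !split; lra.
Qed.

End Components.

Lemma sum_skew_I4 (K : realType) (a b : 'I_4 -> 'I_4 -> K) :
  (forall p q, a p q = - a q p) -> (forall p q, b p q = - b q p) ->
  \sum_p \sum_q a p q * b p q =
  2 * (a i1 i2 * b i1 i2 + a i1 i3 * b i1 i3 + a i1 i4 * b i1 i4 +
       a i2 i3 * b i2 i3 + a i2 i4 * b i2 i4 + a i3 i4 * b i3 i4).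
Proof.
move=> sa sb; rewrite !sum_I4.
have a0 i : a i i = 0 by have := sa i i; lra.
rewrite !a0 (sa i2 i1) (sa i3 i1) (sa i4 i1) (sa i3 i2) (sa i4 i2) (sa i4 i3).
rewrite (sb i2 i1) (sb i3 i1) (sb i4 i1) (sb i3 i2) (sb i4 i2) (sb i4 i3).
ring.
Qed.

Section Square.
Variables (K : realType) (R w : 'I_4 -> 'I_4 -> 'I_4 -> 'I_4 -> K).
Variables (m : 'I_4 -> K) (s : K).
Hypotheses (RP : curvature_components R) (wP : curvature_components w).
Hypothesis tr0 : forall i j, \sum_k w i k j k = 0.
Hypothesis m0 : \sum_i m i = 0.
Hypothesis RE : forall i j k l, R i j k l = w i j k l +
  ((m i + m j) / 2 + s / 12) *
    ((i == k)%:R * (j == l)%:R - (i == l)%:R * (j == k)%:R).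

Lemma canonical_decomposition :
  (R i1 i2 i1 i2 = w i1 i2 i1 i2 + ((m i1 + m i2) / 2 + s / 12)) *
  (R i1 i3 i1 i3 = w i1 i3 i1 i3 + ((m i1 + m i3) / 2 + s / 12)) *
  (R i1 i4 i1 i4 = w i1 i4 i1 i4 + ((m i1 + m i4) / 2 + s / 12)) *
  (R i2 i3 i2 i3 = w i2 i3 i2 i3 + ((m i2 + m i3) / 2 + s / 12)) *
  (R i2 i4 i2 i4 = w i2 i4 i2 i4 + ((m i2 + m i4) / 2 + s / 12)) *
  (R i3 i4 i3 i4 = w i3 i4 i3 i4 + ((m i3 + m i4) / 2 + s / 12)) *
  (R i1 i2 i1 i3 = w i1 i2 i1 i3) * (R i1 i2 i1 i4 = w i1 i2 i1 i4) *
  (R i1 i2 i2 i3 = w i1 i2 i2 i3) * (R i1 i2 i2 i4 = w i1 i2 i2 i4) *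
  (R i1 i3 i1 i4 = w i1 i3 i1 i4) * (R i1 i3 i2 i3 = w i1 i3 i2 i3) *
  (R i1 i3 i3 i4 = w i1 i3 i3 i4) * (R i1 i4 i2 i4 = w i1 i4 i2 i4) *
  (R i1 i4 i3 i4 = w i1 i4 i3 i4) * (R i2 i3 i2 i4 = w i2 i3 i2 i4) *
  (R i2 i3 i3 i4 = w i2 i3 i3 i4) * (R i2 i4 i3 i4 = w i2 i4 i3 i4) *
  (R i1 i2 i3 i4 = w i1 i2 i3 i4) * (R i1 i3 i2 i4 = w i1 i3 i2 i4).
Proof. by do !split; rewrite RE /=; ring. Qed.

(** Here [w] is the Weyl tensor and [m] lists the eigenvalues of the Einstein
tensor, in a frame that diagonalizes the latter. The terms that are
quadratic in [w] alone, in [m] alone or in [s] alone are absorbed by the constant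
[c]; the mixed terms remain. *)
Lemma square_component_traceless :
  exists c, forall i j, \sum_k \sum_p \sum_q R i k p q * R j k p q =
  c * (i == j)%:R
  + 2 * (\sum_p w i p j p * m p) + s / 3 * m i * (i == j)%:R.
Proof.
have m4 : m i4 = - (m i1 + m i2 + m i3) by move: m0; rewrite sum_I4; lra.
have sq i j : \sum_k \sum_p \sum_q R i k p q * R j k p q = 2 * \sum_k
  (R i k i1 i2 * R j k i1 i2 + R i k i1 i3 * R j k i1 i3 +
   R i k i1 i4 * R j k i1 i4 + R i k i2 i3 * R j k i2 i3 +
   R i k i2 i4 * R j k i2 i4 + R i k i3 i4 * R j k i3 i4).
  rewrite mulr_sumr; apply: eq_bigr => k _.
  by rewrite sum_skew_I4 //; case: RP.
(* The equation for [i = j = 1], solved for the constant. *)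
exists (2 * (\sum_k
  (R i1 k i1 i2 * R i1 k i1 i2 + R i1 k i1 i3 * R i1 k i1 i3 +
   R i1 k i1 i4 * R i1 k i1 i4 + R i1 k i2 i3 * R i1 k i2 i3 +
   R i1 k i2 i4 * R i1 k i2 i4 + R i1 k i3 i4 * R i1 k i3 i4))
  - 2 * (\sum_p w i1 p i1 p * m p) - s / 3 * m i1).
move=> i j; rewrite sq !sum_I4.
move: i j; do 2!(apply: I4_ind).
all: rewrite /= !(canonical RP) !canonical_decomposition.
all: rewrite !(canonical wP) !(weyl_canonical wP tr0) ?m4.
all: by field.
Qed.

End Square.

(** * Bilinear forms and curvature tensors in orthonormal frames *)

Section Geometry.
Variables (K : realType) (T : oriented_euclidean4 K).
Local Notation g := (inner T).
Local Notation f := (frame T).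
Implicit Types (u : 'I_4 -> T) (x y z w : T).

Definition bilinear_tensor (B : T -> T -> K) : Prop :=
  (forall y, scalar (B^~ y)) /\ (forall x, scalar (B x)).

Lemma innerC x y : g x y = g y x.
Proof. by rewrite hermC expr0 mul1r. Qed.

Lemma inner_lin y : scalar (fun x => g x y).
Proof. by move=> a v w; rewrite linearPl. Qed.

Lemma inner_lin_r x : scalar (g x).
Proof. by move=> a v w; rewrite linearPr. Qed.

Lemma bilinear_inner : bilinear_tensor (fun x y => g x y).
Proof. by split=> [y|x]; [apply: inner_lin|apply: inner_lin_r]. Qed.

Lemma scalar_sum (n : nat) (F : 'I_n -> T -> K) :
  (forall k, scalar (F k)) -> scalar (fun x => \sum_k F k x).
Proof.
move=> Fl a v w; rewrite /= mulr_sumr -big_split.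
by apply: eq_bigr => k _; apply: Fl.
Qed.

Lemma scalar_scale (F : T -> K) a x : scalar F -> F (a *: x) = a * F x.
Proof.
move=> Fl; have F0 : F 0 = 0 by have := Fl 1 0 0; rewrite scale1r addr0; lra.
by have := Fl a x 0; rewrite addr0 F0 addr0.
Qed.

Lemma orthonormal_frame : orthonormal_basis f.
Proof. by have /andP[] := frameP T. Qed.

Lemma bilinear_expand B u x y : bilinear_tensor B -> orthonormal_basis u ->
  B x y = \sum_i \sum_j g x (u i) * g y (u j) * B (u i) (u j).
Proof.
move=> [Bl Br] ou.
pose Lr z : {scalar T} := HB.pack (B z) (GRing.isLinear.Build _ _ _ _ _ (Br z)).
pose Ll z : {scalar T} :=
  HB.pack (B^~ z) (GRing.isLinear.Build _ _ _ _ _ (Bl z)).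
rewrite {1}(orthonormal_expansion x ou) -[LHS]/(Ll y _) linear_sum.
apply: eq_bigr => i _; rewrite linearZ /=.
rewrite {1}(orthonormal_expansion y ou) -[B _ _]/(Lr (u i) _) linear_sum.
by rewrite mulr_sumr; apply: eq_bigr => j _; rewrite linearZ /= mulrA.
Qed.

Lemma bilinear_ext B B' u :
  bilinear_tensor B -> bilinear_tensor B' -> orthonormal_basis u ->
  (forall i j, B (u i) (u j) = B' (u i) (u j)) -> forall x y, B x y = B' x y.
Proof.
move=> Bb Bb' ou BB x y; rewrite (bilinear_expand x y Bb ou).
rewrite (bilinear_expand x y Bb' ou).
by apply: eq_bigr => i _; apply: eq_bigr => j _; rewrite BB.
Qed.

Lemma bivector_bilinear (b : tensor2 T) : bivector b -> bilinear_tensor b.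
Proof.
move=> [bl bs]; split=> // y a v w.
by rewrite !(bs _ y) bl; ring.
Qed.

Lemma bilinear_skew_ext B B' u : bivector B -> bivector B' ->
  orthonormal_basis u ->
  B (u i1) (u i2) = B' (u i1) (u i2) -> B (u i1) (u i3) = B' (u i1) (u i3) ->
  B (u i1) (u i4) = B' (u i1) (u i4) -> B (u i2) (u i3) = B' (u i2) (u i3) ->
  B (u i2) (u i4) = B' (u i2) (u i4) -> B (u i3) (u i4) = B' (u i3) (u i4) ->
  forall x y, B x y = B' x y.
Proof.
move=> [Br Bs] [Br' Bs'] ou e12 e13 e14 e23 e24 e34.
have skew0 (b : tensor2 T) : (forall x y, b x y = - b y x) ->
    forall x, b x x = 0.
  by move=> bs x; have := bs x x; lra.
have flip x y : B x y = B' x y -> B y x = B' y x.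
  by rewrite (Bs y) (Bs' y) => ->.
apply: (bilinear_ext (u := u)) => //; try exact: bivector_bilinear.
do 2!apply: I4_ind; rewrite ?(skew0 B) ?(skew0 B') //; exact: flip.
Qed.

Section Curvature.
Variable R : tensor4 T.
Hypothesis RP : curvature_tensor R.

Lemma curvature_lin1 y z w : scalar (fun x => R x y z w).
Proof. by case: RP. Qed.
Lemma curvature_lin2 x z w : scalar (fun y => R x y z w).
Proof. by case: RP => _ []. Qed.
Lemma curvature_lin3 x y w : scalar (fun z => R x y z w).
Proof. by case: RP => _ [_ []]. Qed.
Lemma curvature_lin4 x y z : scalar (fun w => R x y z w).
Proof. by case: RP => _ [_ [_ []]]. Qed.
Lemma curvature_skew12 x y z w : R x y z w = - R y x z w.
Proof. by case: RP => _ [_ [_ [_ []]]]. Qed.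
Lemma curvature_skew34 x y z w : R x y z w = - R x y w z.
Proof. by case: RP => _ [_ [_ [_ [_ []]]]]. Qed.
Lemma curvature_pair x y z w : R x y z w = R z w x y.
Proof. by case: RP => _ [_ [_ [_ [_ [_ []]]]]]. Qed.
Lemma curvature_bianchi x y z w : R x y z w + R y z x w + R z x y w = 0.
Proof. by case: RP => _ [_ [_ [_ [_ [_ []]]]]]. Qed.

Lemma ricci_bilinear : bilinear_tensor (ricci R).
Proof.
split=> [y|x]; apply: scalar_sum => k.
  exact: curvature_lin1.
exact: curvature_lin3.
Qed.

Lemma ricciC x y : ricci R x y = ricci R y x.
Proof. by apply: eq_bigr => k _; rewrite curvature_pair. Qed.

Lemma ricci_frame u x y : orthonormal_basis u ->
  ricci R x y = \sum_k R x (u k) y (u k).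
Proof.
move=> ou; apply: (@contraction_frame _ _ (fun v w => R x v y w)) => // z.
  exact: curvature_lin2.
exact: curvature_lin4.
Qed.

Lemma scalar_curvature_frame u : orthonormal_basis u ->
  scalar_curvature R = \sum_i ricci R (u i) (u i).
Proof.
by move=> ou; apply: contraction_frame => //; case: ricci_bilinear.
Qed.

Lemma einstein_bilinear : bilinear_tensor (einstein_tensor R).
Proof.
have [rl rr] := ricci_bilinear.
split=> [y|x] a v w; rewrite /einstein_tensor.
  by rewrite (rl y) (inner_lin y); field.
by rewrite (rr x) (inner_lin_r x); field.
Qed.

Lemma einsteinC x y : einstein_tensor R x y = einstein_tensor R y x.
Proof. by rewrite /einstein_tensor ricciC innerC. Qed.

Lemma weyl_curvature : curvature_tensor (weyl R).
Proof.
have [rl rr] := ricci_bilinear.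
rewrite /weyl; do ![split].
- by move=> y z w a v v' /=; rewrite (curvature_lin1 y z w) !inner_lin !rl; field.
- by move=> y z w a v v' /=; rewrite (curvature_lin2 y z w) !inner_lin !rl; field.
- move=> y z w a v v' /=.
  by rewrite (curvature_lin3 y z w) !inner_lin_r !(rr _ a); field.
- move=> y z w a v v' /=.
  by rewrite (curvature_lin4 y z w) !inner_lin_r !(rr _ a); field.
- by move=> x y z w; rewrite (curvature_skew12 x y); field.
- by move=> x y z w; rewrite (curvature_skew34 x y); field.
- move=> x y z w; rewrite (curvature_pair x y).
  rewrite (innerC z x) (innerC w y) (innerC z y) (innerC w x).
  by rewrite (ricciC z x) (ricciC w y) (ricciC z y) (ricciC w x); field.
- move=> x y z w; have := curvature_bianchi x y z w.
  rewrite (innerC y x) (innerC z x) (innerC z y).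
  by rewrite (ricciC y x) (ricciC z x) (ricciC z y); lra.
Qed.

(** The action contracts the second and fourth slots; the Bianchi identity turns
the result into an evaluation of the last two. *)
Lemma act_wedge v w x y : act R (wedge v w) x y = R x y v w.
Proof.
have -> : act R (wedge v w) x y = R x v y w - R x w y v.
  have B : bilinear_tensor (fun p q => R x p y q).
    by split=> z; [apply: curvature_lin2|apply: curvature_lin4].
  rewrite (bilinear_expand v w B orthonormal_frame).
  rewrite (bilinear_expand w v B orthonormal_frame).
  rewrite -sumrB; apply: eq_bigr => p _; rewrite -sumrB; apply: eq_bigr => q _.
  rewrite /wedge; ring.
have := curvature_bianchi x v y w.
rewrite (curvature_pair x w) (curvature_skew12 y v) (curvature_skew12 y x).
lra.
Qed.

End Curvature.

Lemma components_curvature R u : curvature_tensor R ->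
  curvature_components (fun i j k l => R (u i) (u j) (u k) (u l)).
Proof. by move=> [_ [_ [_ [_ [? [? []]]]]]]. Qed.

End Geometry.

(** * Volume form and Hodge star in a positive orthonormal frame *)

(** Laplace expansion along the first two rows, the shape that makes the volume
form a sum of products of wedges. *)
Lemma det_mx44 (A : comNzRingType) (M : 'I_4 -> 'I_4 -> A) :
  \det (\matrix_(i < 4, j < 4) M i j) =
  (M i1 i1 * M i2 i2 - M i1 i2 * M i2 i1) * (M i3 i3 * M i4 i4 - M i3 i4 * M i4 i3)
  - (M i1 i1 * M i2 i3 - M i1 i3 * M i2 i1) * (M i3 i2 * M i4 i4 - M i3 i4 * M i4 i2)
  + (M i1 i1 * M i2 i4 - M i1 i4 * M i2 i1) * (M i3 i2 * M i4 i3 - M i3 i3 * M i4 i2)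
  + (M i1 i2 * M i2 i3 - M i1 i3 * M i2 i2) * (M i3 i1 * M i4 i4 - M i3 i4 * M i4 i1)
  - (M i1 i2 * M i2 i4 - M i1 i4 * M i2 i2) * (M i3 i1 * M i4 i3 - M i3 i3 * M i4 i1)
  + (M i1 i3 * M i2 i4 - M i1 i4 * M i2 i3) * (M i3 i1 * M i4 i2 - M i3 i2 * M i4 i1).
Proof.
pose N (a b : nat) := M (inord a) (inord b).
have MN i j : M i j = N i j by rewrite /N !inord_val.
rewrite !MN; under eq_mx => i j do rewrite MN.
do 3!rewrite !(expand_det_row _ ord0) !big_ord_recl !big_ord0 /cofactor.
rewrite !det_mx11 !mxE /= /bump /=.
rewrite !addn0 !add0n !expr0 !exprS.
ring.
Qed.

Section Hodge.
Variables (K : realType) (T : oriented_euclidean4 K).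
Local Notation f := (frame T).
Implicit Types (u : 'I_4 -> T) (x y z w : T).

Lemma volumeE u x y z w : positive_orthonormal_basis u ->
  volume x y z w =
  wedge (u i1) (u i2) x y * wedge (u i3) (u i4) z w
  + wedge (u i3) (u i4) x y * wedge (u i1) (u i2) z w
  + wedge (u i1) (u i3) x y * wedge (u i4) (u i2) z w
  + wedge (u i4) (u i2) x y * wedge (u i1) (u i3) z w
  + wedge (u i1) (u i4) x y * wedge (u i2) (u i3) z w
  + wedge (u i2) (u i3) x y * wedge (u i1) (u i4) z w.
Proof.
move=> pu; rewrite (volume_frame x y z w pu) det_mx44 /wedge.
rewrite !(tnth_nth x) /= !(innerC (u _)); ring.
Qed.

Lemma bivector_wedge v w : bivector (wedge v w : tensor2 T).
Proof.
split=> [x a y z|x y]; rewrite /wedge; last by ring.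
by rewrite !(inner_lin_r _ a); ring.
Qed.

(** The two terms of the wedge contract to [b v w] and [- b w v], which agree. *)
Lemma wedge_contract (b : tensor2 T) v w : bivector b ->
  \sum_k \sum_l wedge v w (f k) (f l) * b (f k) (f l) = 2 * b v w.
Proof.
move=> bb; have B := bivector_bilinear bb; have [_ bs] := bb.
rewrite mulrDl !mul1r {2}bs.
rewrite (bilinear_expand v w B (orthonormal_frame T)).
rewrite (bilinear_expand w v B (orthonormal_frame T)).
rewrite -sumrB; apply: eq_bigr => p _; rewrite -sumrB; apply: eq_bigr => q _.
by rewrite /wedge; ring.
Qed.

Lemma hodgeE u (b : tensor2 T) x y : positive_orthonormal_basis u ->
  bivector b -> hodge b x y =
  wedge (u i1) (u i2) x y * b (u i3) (u i4)
  + wedge (u i3) (u i4) x y * b (u i1) (u i2)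
  + wedge (u i1) (u i3) x y * b (u i4) (u i2)
  + wedge (u i4) (u i2) x y * b (u i1) (u i3)
  + wedge (u i1) (u i4) x y * b (u i2) (u i3)
  + wedge (u i2) (u i3) x y * b (u i1) (u i4).
Proof.
move=> pu bb; rewrite /hodge.
pose S v w := \sum_k \sum_l wedge v w (f k) (f l) * b (f k) (f l).
have SE v w : b v w = 2^-1 * S v w by rewrite /S wedge_contract //; field.
rewrite !SE !mulrA -!(mulrC 2^-1) -!mulrA -!mulrDr; congr (_ * _).
rewrite /S !mulr_sumr -!big_split; apply: eq_bigr => k _ /=.
rewrite !mulr_sumr -!big_split; apply: eq_bigr => l _ /=.
rewrite (volumeE _ _ _ _ pu); ring.
Qed.
End Hodge.

(** * Diagonal Weyl operators on self-dual and anti-self-dual bivectors *)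

Section Lambda.
Variables (K : realType) (T : oriented_euclidean4 K).
Implicit Types (u : 'I_4 -> T) (x y z w : T).

Lemma wedge_frame u i j k l : orthonormal_basis u ->
  wedge (u i) (u j) (u k) (u l) =
  (i == k)%:R * (j == l)%:R - (i == l)%:R * (j == k)%:R.
Proof. by move=> /orthonormal_basisP ou; rewrite /wedge !ou. Qed.

Lemma Lambda_basisE u (eps : K) x y :
  (Lambda_basis u eps ord0 x y =
     wedge (u i1) (u i2) x y + eps * wedge (u i3) (u i4) x y) *
  (Lambda_basis u eps (lift ord0 ord0) x y =
     wedge (u i1) (u i3) x y + eps * wedge (u i4) (u i2) x y) *
  (Lambda_basis u eps (lift ord0 (lift ord0 ord0)) x y =
     wedge (u i1) (u i4) x y + eps * wedge (u i2) (u i3) x y).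
Proof. by []. Qed.

Lemma I3_ind (P : 'I_3 -> Prop) :
  P ord0 -> P (lift ord0 ord0) -> P (lift ord0 (lift ord0 ord0)) ->
  forall j, P j.
Proof.
move=> P0 P1 P2 [[|[|[|//]]] ltj].
- by rewrite (_ : Ordinal ltj = ord0) //; apply: val_inj.
- by rewrite (_ : Ordinal ltj = lift ord0 ord0) //; apply: val_inj.
- by rewrite (_ : Ordinal ltj = lift ord0 (lift ord0 ord0)) //; apply: val_inj.
Qed.

Lemma bivectorD (a : K) (b c : tensor2 T) : bivector b -> bivector c ->
  bivector (fun x y => b x y + a * c x y).
Proof.
move=> [bl bs] [cl cs]; split=> [x k v w|x y].
  by rewrite bl cl; ring.
by rewrite bs cs; ring.
Qed.

Lemma Lambda_basis_bivector u (eps : K) j : bivector (Lambda_basis u eps j).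
Proof.
by move: j; apply: I3_ind; rewrite /Lambda_basis (tnth_nth (fun _ _ => 0)) /=;
  apply: bivectorD; apply: bivector_wedge.
Qed.

(** An element of the eigenspace is determined by its values on the pairs
[(u_1, u_j)], since the Hodge star exchanges these with the complementary pairs;
these values are its coordinates. *)
Lemma basis_of_Lambda_basis u (eps : K) :
  positive_orthonormal_basis u -> eps * eps = 1 ->
  basis_of_Lambda eps (Lambda_basis u eps).
Proof.
move=> pu ee; have /andP[ou _] := pu.
split=> [j|c [cb ch]].
  split=> [|x y]; first exact: Lambda_basis_bivector.
  rewrite (hodgeE x y pu (Lambda_basis_bivector u eps j)).
  by move: j; apply: I3_ind; rewrite !Lambda_basisE !(wedge_frame _ _ _ _ ou) /=;
    ring: ee.
have [cl cs] := cb.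
have c34 : c (u i3) (u i4) = eps * c (u i1) (u i2).
  by rewrite -ch (hodgeE _ _ pu cb) !(wedge_frame _ _ _ _ ou) /=; ring.
have c42 : c (u i4) (u i2) = eps * c (u i1) (u i3).
  by rewrite -ch (hodgeE _ _ pu cb) !(wedge_frame _ _ _ _ ou) /=; ring.
have c23 : c (u i2) (u i3) = eps * c (u i1) (u i4).
  by rewrite -ch (hodgeE _ _ pu cb) !(wedge_frame _ _ _ _ ou) /=; ring.
exists (\row_j tnth [tuple c (u i1) (u i2); c (u i1) (u i3); c (u i1) (u i4)] j).
split=> [x y|a ca].
  rewrite !big_ord_recl big_ord0 !mxE !(tnth_nth 0) /= !Lambda_basisE.
  rewrite -[LHS]mul1r -ee -mulrA -ch (hodgeE _ _ pu cb) c34 c42 c23.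
  by ring: ee.
apply/rowP; apply: I3_ind; rewrite mxE (tnth_nth 0) /= ca !big_ord_recl big_ord0.
all: by rewrite !Lambda_basisE !(wedge_frame _ _ _ _ ou) /=; ring.
Qed.

(** If [X + eps Y = (eps c + d) (P + eps Q)] for both signs [eps], then
[X = c Q + d P] and [Y = c P + d Q], and conversely. Apply this to each of the
three pairs of complementary coordinate planes. *)
Lemma weyl_diagonal_form u (W : tensor4 T) (s c2 c3 c4 : K) :
  positive_orthonormal_basis u -> curvature_tensor W ->
  (forall sg : bool, let eps : K := (-1) ^+ sg in
    diagonalizes_on_Lambda eps W (Lambda_basis u eps)
      (tnth [tuple eps * c2 - s / 12; eps * c3 - s / 12; eps * c4 + s / 6]))
  <->
  (forall x y,
    [/\ W x y (u i1) (u i2) =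
          c2 * wedge (u i3) (u i4) x y - s / 12 * wedge (u i1) (u i2) x y,
        W x y (u i3) (u i4) =
          c2 * wedge (u i1) (u i2) x y - s / 12 * wedge (u i3) (u i4) x y &
        W x y (u i1) (u i3) =
          c3 * wedge (u i4) (u i2) x y - s / 12 * wedge (u i1) (u i3) x y] /\
    [/\ W x y (u i4) (u i2) =
          c3 * wedge (u i1) (u i3) x y - s / 12 * wedge (u i4) (u i2) x y,
        W x y (u i1) (u i4) =
          c4 * wedge (u i2) (u i3) x y + s / 6 * wedge (u i1) (u i4) x y &
        W x y (u i2) (u i3) =
          c4 * wedge (u i1) (u i4) x y + s / 6 * wedge (u i2) (u i3) x y]).
Proof.
move=> pu WP.
have actE eps x y :
  (act W (Lambda_basis u eps ord0) x y =
     W x y (u i1) (u i2) + eps * W x y (u i3) (u i4)) *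
  (act W (Lambda_basis u eps (lift ord0 ord0)) x y =
     W x y (u i1) (u i3) + eps * W x y (u i4) (u i2)) *
  (act W (Lambda_basis u eps (lift ord0 (lift ord0 ord0))) x y =
     W x y (u i1) (u i4) + eps * W x y (u i2) (u i3)).
  rewrite -!(act_wedge WP); do !split; rewrite /act mulr_sumr -big_split;
  apply: eq_bigr => p _ /=; rewrite mulr_sumr -big_split; apply: eq_bigr => q _;
  rewrite Lambda_basisE /=; ring.
split=> [D x y|D sg eps].
  have [_ Dp] := D false; have [_ Dm] := D true.
  move: (Dp ord0 x y) (Dm ord0 x y).
  move: (Dp (lift ord0 ord0) x y) (Dm (lift ord0 ord0) x y).
  move: (Dp (lift ord0 (lift ord0 ord0)) x y) (Dm (lift ord0 (lift ord0 ord0)) x y).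
  rewrite !actE !Lambda_basisE !(tnth_nth 0) /= expr0 expr1 => *.
  split; split; lra.
have ee : eps * eps = 1 by rewrite /eps -expr2 sqrr_sign.
split=> [|j x y]; first exact: basis_of_Lambda_basis.
have [[e12 e34 e13] [e42 e14 e23]] := D x y.
move: j; apply: I3_ind; rewrite !actE !Lambda_basisE !(tnth_nth 0) /=.
all: rewrite ?(e12, e34, e13, e42, e14, e23).
all: by ring: ee.
Qed.
End Lambda.

(** * The weakly Einstein condition in an eigenframe *)

Section WeaklyEinstein.
Variables (K : realType) (T : oriented_euclidean4 K).
Local Notation f := (frame T).
Variables (R : tensor4 T).
Hypothesis RP : curvature_tensor R.
Implicit Types (u : 'I_4 -> T) (x y z w : T).

Lemma diagonalizes_einsteinP u (m : 'I_4 -> K) : orthonormal_basis u ->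
  diagonalizes (einstein_tensor R) u m <->
  (forall i j, einstein_tensor R (u i) (u j) = m i * (i == j)%:R).
Proof.
move=> ou; have [el er] := einstein_bilinear RP.
split=> [D i j|D i].
  by rewrite -(inner_sharp _ _ el er) D linearZl_LR /= (orthonormal_basisP _ ou).
rewrite [LHS](orthonormal_expansion _ ou) (bigD1 i) //= big1 ?addr0 => [|j ji].
  by rewrite (inner_sharp _ _ el er) D eqxx mulr1.
by rewrite (inner_sharp _ _ el er) D eq_sym (negPf ji) mulr0 scale0r.
Qed.

Lemma square_bilinear :
  bilinear_tensor (fun x y => \sum_k \sum_p \sum_q
    R x (f k) (f p) (f q) * R y (f k) (f p) (f q)).
Proof.
split=> [y|x]; do 3!apply: scalar_sum => ?; move=> a v w.
  by rewrite (curvature_lin1 RP); ring.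
by rewrite (curvature_lin1 RP); ring.
Qed.

Lemma square_frame u x y : orthonormal_basis u ->
  \sum_k \sum_p \sum_q R x (f k) (f p) (f q) * R y (f k) (f p) (f q) =
  \sum_k \sum_p \sum_q R x (u k) (u p) (u q) * R y (u k) (u p) (u q).
Proof.
move=> ou.
have l2 := curvature_lin2 RP; have l3 := curvature_lin3 RP.
have l4 := curvature_lin4 RP.
rewrite (@contraction_frame _ _
  (fun v w => \sum_p \sum_q R x v (f p) (f q) * R y w (f p) (f q)) u) //.
- apply: eq_bigr => k _.
  rewrite (@contraction_frame _ _
    (fun v w => \sum_q R x (u k) v (f q) * R y (u k) w (f q)) u) //.
  + apply: eq_bigr => p _.
    rewrite (@contraction_frame _ _
      (fun v w => R x (u k) (u p) v * R y (u k) (u p) w) u) //.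
    * by move=> z a v w /=; rewrite l4; ring.
    * by move=> z a v w /=; rewrite l4; ring.
  + by move=> z; apply: scalar_sum => q a v w; rewrite l3; ring.
  + by move=> z; apply: scalar_sum => q a v w; rewrite l3; ring.
- by move=> z; do 2!apply: scalar_sum => ?; move=> a v w; rewrite l2; ring.
- by move=> z; do 2!apply: scalar_sum => ?; move=> a v w; rewrite l2; ring.
Qed.

Lemma weakly_einstein_frame u : orthonormal_basis u ->
  weakly_einstein R <->
  exists c, forall i j, \sum_k \sum_p \sum_q
    R (u i) (u k) (u p) (u q) * R (u j) (u k) (u p) (u q) = c * (i == j)%:R.
Proof.
move=> ou; split=> -[c E]; exists c.
  by move=> i j; rewrite -(square_frame _ _ ou) E (orthonormal_basisP _ ou).
apply: (bilinear_ext (u := u)) => //; first exact: square_bilinear.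
  by split=> z a v w; rewrite ?(inner_lin z) ?(inner_lin_r z); ring.
by move=> i j; rewrite (square_frame _ _ ou) E (orthonormal_basisP _ ou).
Qed.

Section Frame.
Variable u : 'I_4 -> T.
Hypothesis ou : orthonormal_basis u.
Let ouE := orthonormal_basisP _ ou.

Lemma weyl_tracefree i j : \sum_k weyl R (u i) (u k) (u j) (u k) = 0.
Proof.
have rE := ricci_frame RP (u i) (u j) ou.
move: rE; rewrite /weyl (scalar_curvature_frame RP ou) !sum_I4 !ouE.
by move: i j; do 2!(apply: I4_ind) => /=; lra.
Qed.

Lemma einstein_tracefree : \sum_i einstein_tensor R (u i) (u i) = 0.
Proof.
rewrite /einstein_tensor (scalar_curvature_frame RP ou) !sum_I4 !ouE /=.
lra.
Qed.

Variable m : 'I_4 -> K.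
Hypothesis em : forall i j, einstein_tensor R (u i) (u j) = m i * (i == j)%:R.

Lemma eigenvalues_sum0 : \sum_i m i = 0.
Proof.
by rewrite -[RHS]einstein_tracefree; apply: eq_bigr => i _; rewrite em eqxx mulr1.
Qed.

(** The definition of the Weyl tensor, solved for [R] in an eigenframe of the
Einstein tensor. *)
Lemma curvature_decomposition i j k l :
  R (u i) (u j) (u k) (u l) = weyl R (u i) (u j) (u k) (u l) +
  ((m i + m j) / 2 + scalar_curvature R / 12) *
    ((i == k)%:R * (j == l)%:R - (i == l)%:R * (j == k)%:R).
Proof.
have rE a b : ricci R (u a) (u b) =
    (m a + scalar_curvature R / 4) * (a == b)%:R.
  by move: (em a b); rewrite /einstein_tensor ouE; lra.
by rewrite /weyl !rE !ouE; field.
Qed.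

(** The right-hand side is [W e = - (s/6) e], with [W] acting on symmetric
tensors. It is traceless, and so is [e]; hence the constant in front of [g] in
[square_component_traceless] is the one in the weakly Einstein condition. *)
Lemma weakly_einstein_diagP :
  weakly_einstein R <->
  forall i j, \sum_p weyl R (u i) (u p) (u j) (u p) * m p =
    - (scalar_curvature R / 6) * m i * (i == j)%:R.
Proof.
have WP := components_curvature u (weyl_curvature RP).
have [c cE] := square_component_traceless (components_curvature u RP) WP
  weyl_tracefree eigenvalues_sum0 curvature_decomposition.
apply: (iff_trans (weakly_einstein_frame ou)); split=> [[c' c'E]|H]; last first.
  by exists c => i j; rewrite cE H; field.
have cc : c = c'.
  have tr : \sum_i \sum_p weyl R (u i) (u p) (u i) (u p) * m p = 0.
    rewrite exchange_big big1 //= => p _; rewrite -mulr_suml.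
    under eq_bigr => i _ do rewrite (curvature_skew12 (weyl_curvature RP))
      (curvature_skew34 (weyl_curvature RP)) opprK.
    by rewrite weyl_tracefree mul0r.
  have sm0 : scalar_curvature R * (m i1 + m i2 + m i3 + m i4) = 0.
    by rewrite -(sum_I4 m) eigenvalues_sum0 mulr0.
  move: tr sm0; rewrite (sum_I4 (fun i => \sum_p _)).
  have := (cE i1 i1, cE i2 i2, cE i3 i3, cE i4 i4).
  rewrite !c'E /= => -[[[]]]; lra.
by move=> i j; move: (cE i j); rewrite c'E cc; lra.
Qed.
End Frame.
End WeaklyEinstein.

(** * Curvature tensors of the prescribed form *)

(** Reduces a property of components that is invariant under the skew symmetries
to the 36 components with ascending index pairs. *)
Lemma ordered_pairs_ind (Q : 'I_4 -> 'I_4 -> 'I_4 -> 'I_4 -> Prop) :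
  (forall i j k l, Q i j k l -> Q j i k l) ->
  (forall i j k l, Q i j k l -> Q i j l k) ->
  (forall i k l, Q i i k l) -> (forall i j k, Q i j k k) ->
  (forall i j k l : 'I_4, (i < j)%N -> (k < l)%N -> Q i j k l) ->
  forall i j k l, Q i j k l.
Proof.
move=> s12 s34 d12 d34 Qlt i j k l.
case: (ltngtP i j) => [ij|ij|/val_inj <-//]; last apply: s12;
case: (ltngtP k l) => [kl|kl|/val_inj <-//]; try exact: Qlt;
by apply: s34; apply: Qlt.
Qed.

Section DiagonalWeyl.
Variables (K : realType) (T : oriented_euclidean4 K).
Variables (R : tensor4 T) (u : 'I_4 -> T) (s lam mu c2 c3 c4 : K).
Hypotheses (RP : curvature_tensor R) (pu : positive_orthonormal_basis u).
Hypothesis sR : scalar_curvature R = s.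
Hypothesis pf : prescribed_form R u s lam mu c2 c3 c4.
Let W i j k l := weyl R (u i) (u j) (u k) (u l).

Let ou : orthonormal_basis u.
Proof. by case/andP: pu. Qed.

Lemma weyl_components i j :
  (W i j i1 i2 =
    c2 * wedge (u i3) (u i4) (u i) (u j) - s / 12 * wedge (u i1) (u i2) (u i) (u j)) *
  (W i j i3 i4 =
    c2 * wedge (u i1) (u i2) (u i) (u j) - s / 12 * wedge (u i3) (u i4) (u i) (u j)) *
  (W i j i1 i3 =
    c3 * wedge (u i4) (u i2) (u i) (u j) - s / 12 * wedge (u i1) (u i3) (u i) (u j)) *
  (W i j i2 i4 =
    - (c3 * wedge (u i1) (u i3) (u i) (u j) - s / 12 * wedge (u i4) (u i2) (u i) (u j))) *
  (W i j i1 i4 =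
    c4 * wedge (u i2) (u i3) (u i) (u j) + s / 6 * wedge (u i1) (u i4) (u i) (u j)) *
  (W i j i2 i3 =
    c4 * wedge (u i1) (u i4) (u i) (u j) + s / 6 * wedge (u i2) (u i3) (u i) (u j)).
Proof.
case: pf => _ /(weyl_diagonal_form _ _ _ _ pu (weyl_curvature RP)).
move=> /(_ (u i) (u j))[[e12 e34 e13] [e42 e14 e23]].
rewrite /W -e42; do !split=> //.
by rewrite (curvature_skew34 (weyl_curvature RP)).
Qed.

Let WP : curvature_components W := components_curvature u (weyl_curvature RP).

Lemma weyl_componentE :
  (W i1 i2 i1 i2 = - s / 12) * (W i1 i3 i1 i3 = - s / 12) *
  (W i1 i4 i1 i4 = s / 6) * (W i3 i4 i3 i4 = - s / 12) *
  (W i2 i4 i2 i4 = - s / 12) * (W i2 i3 i2 i3 = s / 6) *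
  (W i1 i2 i3 i4 = c2) * (W i1 i3 i2 i4 = - c3) * (W i1 i4 i2 i3 = c4).
Proof.
by do !split; rewrite weyl_components !(wedge_frame _ _ _ _ ou) /=; ring.
Qed.

Lemma weyl_component0 :
  (W i1 i2 i1 i3 = 0) * (W i1 i2 i1 i4 = 0) * (W i1 i2 i2 i3 = 0) *
  (W i1 i2 i2 i4 = 0) * (W i1 i3 i1 i4 = 0) * (W i1 i3 i2 i3 = 0) *
  (W i1 i3 i3 i4 = 0) * (W i1 i4 i2 i4 = 0) * (W i1 i4 i3 i4 = 0) *
  (W i2 i3 i2 i4 = 0) * (W i2 i3 i3 i4 = 0) * (W i2 i4 i3 i4 = 0).
Proof.
by do !split; rewrite weyl_components !(wedge_frame _ _ _ _ ou) /=; ring.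
Qed.

Lemma prescribed_weakly_einstein : weakly_einstein R.
Proof.
have [/(diagonalizes_einsteinP RP _ ou) em _] := pf.
apply/(weakly_einstein_diagP RP ou em); rewrite -/W => i j.
rewrite sum_I4 -!/(W _ _ _ _) sR !(tnth_nth 0).
move: i j; do 2!apply: I4_ind; rewrite /= ?(canonical12 WP) ?(canonical34 WP).
all: rewrite ?(component_diag12 WP) ?(component_diag34 WP) ?(canonical_pairs WP).
all: by rewrite ?weyl_componentE ?weyl_component0; field.
Qed.

Lemma weyl_component_listed i j k l : W i j k l <> 0 ->
  exists2 q : quad, q \in listed_components & alg_related q (i, j, k, l).
Proof.
case: (WP) => s12 s34 _ _.
move: i j k l; apply: ordered_pairs_ind.
- move=> i j k l H; rewrite s12 => /eqP; rewrite oppr_eq0 => /eqP /H[q ql qa].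
  by exists q; last exact: alg_related_swap12.
- move=> i j k l H; rewrite s34 => /eqP; rewrite oppr_eq0 => /eqP /H[q ql qa].
  by exists q; last exact: alg_related_swap34.
- by move=> i k l; rewrite (component_diag12 WP).
- by move=> i j k; rewrite (component_diag34 WP).
do 4!apply: I4_ind => //; move=> _ _; rewrite ?(canonical_pairs WP).
all: rewrite ?weyl_component0 // => _.
all: first
  [ by eexists; last exact: alg_related_refl
  | by eexists; last (apply: alg_related_swap34; exact: alg_related_refl)
  | by eexists; last (apply: alg_related_swap_pairs; exact: alg_related_refl)
  | by eexists; last (apply: alg_related_swap_pairs; apply: alg_related_swap34;
      exact: alg_related_refl) ].
Qed.
End DiagonalWeyl.

(** * Sorted orthonormal eigenframes of symmetric forms *)

Section Spectral.
Variables (K : realType) (T : oriented_euclidean4 K).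
Local Notation g := (inner T).
Local Notation f := (frame T).
Implicit Types (u : 'I_4 -> T) (x y z w : T) (B : T -> T -> K).

Definition rotate (i j : 'I_4) (c s : K) u : 'I_4 -> T := fun k =>
  if k == i then c *: u i + s *: u j
  else if k == j then c *: u j - s *: u i else u k.

Lemma bilinear_comb B a b a' b' x y x' y' : bilinear_tensor B ->
  B (a *: x + b *: y) (a' *: x' + b' *: y') =
  a * a' * B x x' + a * b' * B x y' + b * a' * B y x' + b * b' * B y y'.
Proof.
move=> [Bl Br].
have BZl k v z : B (k *: v) z = k * B v z := scalar_scale k v (Bl z).
have BZr k v z : B v (k *: z) = k * B v z := scalar_scale k z (Br v).
by rewrite Bl Br BZl !BZr Br BZr; ring.
Qed.

Lemma rotateE i j c s u : i != j ->
  (rotate i j c s u i = c *: u i + s *: u j) *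
  (rotate i j c s u j = (- s) *: u i + c *: u j).
Proof.
move=> /negPf ij; rewrite /rotate !eqxx eq_sym ij; split=> //.
by rewrite addrC scaleNr.
Qed.

Lemma rotateN i j c s u k : k != i -> k != j -> rotate i j c s u k = u k.
Proof. by rewrite /rotate => /negPf -> /negPf ->. Qed.

Lemma rotate_orthonormal i j c s u : i != j -> c ^+ 2 + s ^+ 2 = 1 ->
  orthonormal_basis u -> orthonormal_basis (rotate i j c s u).
Proof.
move=> ij cs /orthonormal_basisP ou; apply/orthonormal_basisP => k l.
have gl z a b x y : g (a *: x + b *: y) z = a * g x z + b * g y z.
  by rewrite linearDl linearZl_LR /= linearZl_LR.
have rE := rotateE c s u ij; have /negPf ijF := ij.
have [->|ki] := eqVneq k i; last have [->|kj] := eqVneq k j.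
all: have [->|li] := eqVneq l i; last have [->|lj] := eqVneq l j.
all: rewrite ?rE ?(rotateN _ _ _ ki kj) ?(rotateN _ _ _ li lj) ?ou //.
all: rewrite ?gl ?(innerC _ (_ + _)) ?gl ?ou ?eqxx ?(eq_sym j i) ?ijF.
all: rewrite ?(eq_sym i l) ?(eq_sym j l) ?(eq_sym i k) ?(eq_sym j k) ?(negPf li)
  ?(negPf lj) ?(negPf ki) ?(negPf kj) /=; lra.
Qed.

(** Orthonormal frames, written in coordinates with respect to a fixed one, form
a closed subset of a cube, hence a compact set. *)
Lemma exists_max_orthonormal (B : 'I_4 -> T -> T -> K) :
  (forall i, bilinear_tensor (B i)) ->
  exists2 u, orthonormal_basis u &
    forall v, orthonormal_basis v ->
      \sum_i B i (v i) (v i) <= \sum_i B i (u i) (u i).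
Proof.
move=> Bb.
pose U (v : 'rV[K]_(4 * 4)) (i : 'I_4) : T :=
  \sum_k v ord0 (mxvec_index i k) *: f k.
pose A : set 'rV[K]_(4 * 4) := [set v | orthonormal_basis (U v)]%classic.
have of_ := orthonormal_frame T.
have gU v i k : g (U v i) (f k) = v ord0 (mxvec_index i k).
  by rewrite /U (inner_comb (fun k => v ord0 (mxvec_index i k))).
have UK u i : U (mxvec (\matrix_(i, k) g (u i) (f k))) i = u i.
  rewrite [RHS](orthonormal_expansion _ of_) /U; apply: eq_bigr => k _.
  by rewrite mxvecE mxE.
have Ucont C i j : bilinear_tensor C -> continuous (fun v => C (U v i) (U v j)).
  move=> Cb; have -> : (fun v => C (U v i) (U v j)) = (fun v =>
    \sum_k \sum_l v ord0 (mxvec_index i k) * v ord0 (mxvec_index j l) *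
      C (f k) (f l)).
    apply/funext => v; rewrite (bilinear_expand _ _ Cb of_).
    by apply: eq_bigr => k _; apply: eq_bigr => l _; rewrite !gU.
  apply: continuous_big => [|k _]; first exact: add_continuous.
  apply: continuous_big => [|l _ v]; first exact: add_continuous.
  pose X m (v : 'rV[K]_(4 * 4)) := v ord0 m.
  have Xcont m : continuous (X m) by exact: coord_continuous.
  apply: (@continuousM _ _ (X (mxvec_index i k) \* X (mxvec_index j l))
    (fun=> C (f k) (f l))); last exact: cst_continuous.
  by apply: continuousM; apply: Xcont.
have Acl : closed A.
  have -> : A = (\bigcap_(p in @setT ('I_4 * 'I_4))
      (fun v => g (U v p.1) (U v p.2)) @^-1` [set x | x = (p.1 == p.2)%:R])%classic.
    apply/seteqP; split=> v Av.
      by move=> p _; apply: (orthonormal_basisP _ Av).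
    by apply/orthonormal_basisP => i j; apply: (Av (i, j)).
  apply: closed_bigI => p _; apply: closed_comp => [v _|]; last exact: closed_eq.
  apply: (Ucont _ _ _ (bilinear_inner T)).
have cA : compact A.
  apply: (subclosed_compact Acl).
    apply: (@rV_compact _ _ (fun=> `[(-1 : K), 1]%classic)) => _.
    exact: segment_compact.
  move=> v Av i /=; case/mxvec_indexP: i => i k.
  rewrite -gU in_itv /= -ler_norml -(@ler_pXn2r _ 2) ?nnegrE //.
  rewrite real_normK ?num_real // expr1n.
  have e : 1 = \sum_k g (U v i) (f k) ^+ 2.
    transitivity (g (U v i) (U v i)); last exact: orthonormal_parseval.
    by rewrite (orthonormal_basisP _ Av) eqxx.
  by rewrite [leRHS]e (bigD1 k) //= lerDl sumr_ge0 // => l _; apply: sqr_ge0.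
have A0 : (A !=set0)%classic.
  exists (mxvec (\matrix_(i, k) g (f i) (f k))).
  by apply/orthonormal_basisP => i j; rewrite !UK; apply/orthonormal_basisP.
pose F v := \sum_i B i (U v i) (U v i).
have Fcont : {within A, continuous F}%classic.
  apply: continuous_subspaceT; apply: continuous_big => [|i _].
    exact: add_continuous.
  exact: Ucont.
have [v /set_mem Av max] := compact_EVT_max A0 cA Fcont.
exists (U v) => // w ow.
have -> : \sum_i B i (w i) (w i) = F (mxvec (\matrix_(i, k) g (w i) (f k))).
  by apply: eq_bigr => i _; rewrite UK.
apply: max; apply/mem_set/orthonormal_basisP => i j.
by rewrite !UK; apply/orthonormal_basisP.
Qed.

(** Up to sign, [c] is the cosine of an angle with tangent [t]. *)
Lemma exists_cosine (t : K) :
  exists2 c : K, 0 < c ^+ 2 & c ^+ 2 * (1 + t ^+ 2) = 1.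
Proof.
have t2 : 0 < 1 + t ^+ 2 by rewrite ltr_pwDl // sqr_ge0.
exists (Num.sqrt (1 + t ^+ 2))^-1; first by rewrite exprn_gt0 // invr_gt0 sqrtr_gt0.
by rewrite exprVn sqr_sqrtr ?ltW // mulVf // gt_eqF.
Qed.

(** Take a maximizer of [sum_i i B (u_i, u_i)]. Rotating it in the plane of
[u_i, u_j], [i < j], cannot increase the sum; the rotation by a right angle
yields the order of the eigenvalues, small rotations yield [B (u_i, u_j) = 0]. *)
Lemma exists_sorted_eigenframe B : bilinear_tensor B ->
  (forall x y, B x y = B y x) ->
  exists2 u, orthonormal_basis u &
    (forall i j, i != j -> B (u i) (u j) = 0) /\
    (forall i j : 'I_4, (i < j)%N -> B (u i) (u i) <= B (u j) (u j)).
Proof.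
move=> Bb BC.
have [|u ou max] := @exists_max_orthonormal (fun i x y => i%:R * B x y).
  by case: Bb => Bl Br i; split=> z a v w; rewrite ?Bl ?Br; ring.
have step (i j : 'I_4) (c s : K) : (i < j)%N -> c ^+ 2 + s ^+ 2 = 1 ->
    s ^+ 2 * (B (u i) (u i) - B (u j) (u j)) <= 2 * (c * s) * B (u i) (u j).
  move=> ltij cs; have ij : i != j by rewrite neq_ltn ltij.
  have split2 (v : 'I_4 -> T) : \sum_(k : 'I_4) k%:R * B (v k) (v k) =
      i%:R * B (v i) (v i) + (j%:R * B (v j) (v j) +
      \sum_(k : 'I_4 | (k != i) && (k != j)) k%:R * B (v k) (v k)).
    by rewrite (bigD1 i) //= (bigD1 j) //= eq_sym.
  have := max _ (rotate_orthonormal ij cs ou).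
  rewrite !split2 !rotateE // !bilinear_comb // (BC (u j)).
  rewrite (eq_bigr (fun k : 'I_4 => k%:R * B (u k) (u k))); last first.
    by move=> k /andP[ki kj]; rewrite rotateN.
  have d : 0 < j%:R - i%:R :> K by rewrite subr_gt0 ltr_nat.
  have c2 : c * c = 1 - s * s by lra.
  set p := B (u i) (u i); set q := B (u i) (u j); set r := B (u j) (u j).
  have cp : i%:R * (c * c * p) = i%:R * (p - s * s * p) by rewrite c2; ring.
  have cr : j%:R * (c * c * r) = j%:R * (r - s * s * r) by rewrite c2; ring.
  by move=> H; rewrite -subr_ge0 -(pmulr_rge0 _ d); lra.
have srt (i j : 'I_4) : (i < j)%N -> B (u i) (u i) <= B (u j) (u j).
  move=> ltij; have := step i j 0 1 ltij.
  rewrite expr0n expr1n add0r => /(_ erefl); lra.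
exists u => //; split=> // i j; rewrite neq_ltn.
wlog ltij : i j / (i < j)%N => [W|_].
  by move=> /orP[] ij; [|rewrite BC]; apply: W => //; rewrite ij.
have [p_le_r step_ij] := (srt _ _ ltij, fun c s => step _ _ c s ltij).
move: p_le_r step_ij.
set p := B (u i) (u i); set q := B (u i) (u j); set r := B (u j) (u j).
move=> pr stepij.
(* This [t] makes [2 t q - t^2 (p - r)] negative unless [q = 0]; adding 1 keeps
   the denominator positive when [p = r]. *)
pose t := - q / (r - p + 1).
have qt : q = - t * (r - p + 1) by rewrite /t; field; lra.
have [c c0 cc] := exists_cosine t.
have /stepij ineq : c ^+ 2 + (t * c) ^+ 2 = 1 by rewrite -cc; ring.
have t0 : t ^+ 2 * (r - p + 2) <= 0.
  rewrite -(pmulr_rle0 _ c0); move: ineq; rewrite qt; lra.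
have : t ^+ 2 <= 0 by move: t0; rewrite pmulr_lle0 //; lra.
by rewrite le_eqVlt ltNge sqr_ge0 orbF sqrf_eq0 qt => /eqP ->; rewrite oppr0 mul0r.
Qed.
End Spectral.

(** * Weakly Einstein tensors in an eigenframe *)

Section Eigenframes.
Variables (K : realType) (T : oriented_euclidean4 K).
Local Notation g := (inner T).
Implicit Types (u : 'I_4 -> T) (x y z w : T) (B : tensor2 T) (m : 'I_4 -> K).

Lemma orthonormal_free u (r : seq 'I_4) :
  orthonormal_basis u -> uniq r -> free (map u r).
Proof.
move=> ou; elim: r => [|i r IHr] /=; first by rewrite nil_free.
case/andP => ir ur; rewrite free_cons IHr // andbT; apply/negP => ui_span.
have ui := coord_span (X := in_tuple (map u r)) ui_span.
have := orthonormal_basisP _ ou i i; rewrite eqxx {1}ui linear_sumlz big1.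
  by move/eqP; rewrite eq_sym oner_eq0.
move=> j _; have : (in_tuple (map u r))`_j \in map u r by rewrite mem_nth.
case/mapP=> k kr ->; rewrite linearZl_LR /= (orthonormal_basisP _ ou).
by rewrite (negPf (memPn ir k kr)) mulr0.
Qed.

(** The eigenspace is spanned by the frame vectors that it contains. *)
Lemma multiplicity_diagonal B u m a : orthonormal_basis u ->
  diagonalizes B u m -> multiplicity B a = #|[pred i | m i == a]|.
Proof.
move=> ou D; set P := [pred i | _]; rewrite cardE -(size_map u).
have /eqP <- : free (map u (enum P)) by apply: orthonormal_free; rewrite ?enum_uniq.
rewrite /multiplicity; congr (\dim _); apply/vspaceP => v.
have kerE w : (w \in passmx.leigenspace (sharp B) a) = (sharp B w == a *: w).
  by rewrite memv_ker !lfun_simp subr_eq0.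
apply/idP/idP => [|vP]; last first.
  apply: (subvP _ _ vP); apply/span_subvP => _ /mapP[i iP ->].
  by move: iP; rewrite mem_enum inE kerE D => /eqP ->.
rewrite kerE => /eqP va; rewrite (orthonormal_expansion v ou).
apply: memv_suml => i _; have [mi|mi] := eqVneq (m i) a.
  by rewrite memvZ // memv_span // map_f // mem_enum inE mi.
have : g (sharp B v) (u i) = g v (u i) * m i.
  rewrite {1}(orthonormal_expansion v ou) linear_sum.
  under eq_bigr => j _ do rewrite linearZ /= D scalerA.
  exact: inner_comb.
rewrite va linearZl_LR /= => e; suff -> : g v (u i) = 0 by rewrite scale0r mem0v.
by apply/eqP; apply: contraNT mi => gv0; apply/eqP/(mulfI gv0); rewrite -e mulrC.
Qed.

(** In terms of the tangent [t] of the angle, isotropy is a quadratic equation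
whose coefficients at [1] and [t^2] are opposite, so its discriminant is
nonnegative. *)
Lemma exists_isotropic B x y : bilinear_tensor B -> B x x + B y y = 0 ->
  exists c s : K, c ^+ 2 + s ^+ 2 = 1 /\
    B (c *: x + s *: y) (c *: x + s *: y) = 0.
Proof.
move=> Bb tr; set a := B x x in tr *; have yy : B y y = - a by lra.
set b := B x y + B y x.
have [a0|a0] := eqVneq a 0.
  exists 1, 0; rewrite expr1n expr0n addr0; split=> //.
  by rewrite bilinear_comb // -/a a0; ring.
(* A root of [a + b t - a t^2]. *)
pose t := (b + Num.sqrt (b ^+ 2 + 4 * a ^+ 2)) / (2 * a).
have ht : a + b * t - a * t ^+ 2 = 0.
  have : Num.sqrt (b ^+ 2 + 4 * a ^+ 2) ^+ 2 = b ^+ 2 + 4 * a ^+ 2.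
    by rewrite sqr_sqrtr // addr_ge0 ?sqr_ge0 // mulr_ge0 ?sqr_ge0.
  have -> : Num.sqrt (b ^+ 2 + 4 * a ^+ 2) = 2 * a * t - b.
    by rewrite /t; field.
  move=> h; apply: (mulfI a0); rewrite mulr0; lra.
have [c _ cc] := exists_cosine t.
exists c, (c * t); split; first by rewrite -cc; ring.
rewrite bilinear_comb // yy -/a.
transitivity (c ^+ 2 * (a + b * t - a * t ^+ 2)); first by rewrite /b; ring.
by rewrite ht mulr0.
Qed.

Lemma diagonalizes_rotate B u m i j c s : i != j -> m i = m j ->
  diagonalizes B u m -> diagonalizes B (rotate i j c s u) m.
Proof.
move=> ij mij D k; have rE := rotateE c s u ij.
have [->|ki] := eqVneq k i; last have [->|kj] := eqVneq k j.
- by rewrite rE linearD !linearZ /= !D -mij scalerDr !scalerA !(mulrC (m i)).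
- by rewrite rE linearD !linearZ /= !D mij scalerDr !scalerA !(mulrC (m j)).
- by rewrite rotateN.
Qed.

Definition flip (b : bool) u : 'I_4 -> T :=
  fun k => (-1) ^+ (b && (k == i1)) *: u k.

Lemma diagonalizes_flip B u m b :
  diagonalizes B u m -> diagonalizes B (flip b u) m.
Proof. by move=> D k; rewrite /flip linearZ /= D !scalerA mulrC. Qed.

Lemma exists_flip_positive u : orthonormal_basis u ->
  exists b, positive_orthonormal_basis (flip b u).
Proof.
move=> ou.
have of_ b : orthonormal_basis (flip b u).
  apply/orthonormal_basisP => i j; rewrite /flip linearZl_LR linearZr_LR /=.
  rewrite (orthonormal_basisP _ ou); have [->|_] := eqVneq i j; last by rewrite !mulr0.
  by rewrite mulr1 -signr_addb addbb.
have := orthonormal_det_neq0 ou; rewrite neq_lt => /orP[] du; last first.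
  exists false; apply/andP; split=> //; rewrite /positive_basis.
  congr (_ < \det _): du.
  by apply/matrixP => i j; rewrite !mxE /flip expr0 scale1r.
exists true; apply/andP; split=> //; rewrite /positive_basis.
pose d : 'rV[K]_4 := \row_i (-1) ^+ (i == i1).
set A := \matrix_(i, j) _ in du; set C := \matrix_(i, j) _.
have -> : C = diag_mx d *m A.
  by apply/matrixP => i j; rewrite mul_diag_mx !mxE /flip linearZ.
rewrite det_mulmx det_diag (bigD1 i1) // big1 => [|i /negPf i1F].
  by rewrite /= mxE eqxx mulr1 mulN1r oppr_gt0.
by rewrite mxE i1F.
Qed.

End Eigenframes.

Section Converse.
Variables (K : realType) (T : oriented_euclidean4 K) (R : tensor4 T).
Hypotheses (RP : curvature_tensor R) (wR : weakly_einstein R).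
Local Notation e := (einstein_tensor R).
Local Notation s := (scalar_curvature R).
Implicit Types (u : 'I_4 -> T) (x y z w : T) (m : 'I_4 -> K).

(** An off-diagonal equation of the system [W e = - (s/6) e] involves two
components of [W], which are opposite by trace-freeness. The first three equations
here arise from adding the diagonal ones for [u_1] and [u_j], [j = 2, 3, 4], as
[m_k + m_l = - (m_1 + m_j)] and [W_1k1k + W_1l1l = - W_1j1j]. *)
Lemma weyl_eigenframe u m : orthonormal_basis u -> diagonalizes e u m ->
  let W i j k l := weyl R (u i) (u j) (u k) (u l) in
  [/\ (m i1 + m i2) * (W i1 i2 i1 i2 + s / 12) = 0,
      (m i1 + m i3) * (W i1 i3 i1 i3 + s / 12) = 0 &
      (m i1 + m i4) * (W i1 i4 i1 i4 + s / 12) = 0] /\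
  [/\ (m i3 - m i4) * W i1 i3 i2 i3 = 0, (m i2 - m i4) * W i1 i2 i2 i3 = 0 &
      (m i2 - m i3) * W i1 i2 i2 i4 = 0] /\
  [/\ (m i1 - m i4) * W i1 i2 i1 i3 = 0, (m i1 - m i3) * W i1 i2 i1 i4 = 0 &
      (m i1 - m i2) * W i1 i3 i1 i4 = 0].
Proof.
move=> ou D W; have em := (diagonalizes_einsteinP RP _ ou).1 D.
have weak i j : \sum_p W i p j p * m p = - (s / 6) * m i * (i == j)%:R.
  exact: (weakly_einstein_diagP RP ou em).1 wR i j.
have WP : curvature_components W := components_curvature u (weyl_curvature RP).
have tr0 i j : \sum_k W i k j k = 0 := weyl_tracefree RP ou i j.
have m4 : m i4 = - (m i1 + m i2 + m i3).
  by have := eigenvalues_sum0 RP ou em; rewrite sum_I4; lra.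
have := (weak i1 i1, weak i2 i2, weak i3 i3, weak i1 i2, weak i1 i3, weak i1 i4,
  weak i2 i3, weak i2 i4, weak i3 i4).
rewrite !sum_I4 /= !(canonical12 WP) !(canonical34 WP) !(component_diag12 WP).
rewrite ?(component_diag34 WP) ?(canonical_pairs WP) !(weyl_canonical WP tr0).
rewrite !mulr0 m4.
move=> [[[[[[[[w11 w22] w33] w12] w13] w14] w23] w24] w34].
split; [split|split; split]; lra.
Qed.

(** The eigenvalue conditions leave [W_1224] free only if [mu = 0], which is why
it is assumed to vanish; all other components are determined by
[weyl_eigenframe] and trace-freeness, apart from those with four distinct indices, whose values are
the [c_j]. *)
Lemma prescribed_formP u lam mu :
  positive_orthonormal_basis u -> mu < lam -> 0 <= mu ->
  diagonalizes e u (tnth [tuple - lam; - mu; mu; lam]) ->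
  weyl R (u i1) (u i2) (u i2) (u i4) = 0 ->
  prescribed_form R u s lam mu
    (weyl R (u i1) (u i2) (u i3) (u i4)) (weyl R (u i1) (u i3) (u i4) (u i2))
    (weyl R (u i1) (u i4) (u i2) (u i3)).
Proof.
move=> pu mulam mu0 D W1224; split=> //; have /andP[ou _] := pu.
have Wc := weyl_curvature RP.
apply/(weyl_diagonal_form _ _ _ _ pu Wc).
pose W i j k l := weyl R (u i) (u j) (u k) (u l).
have WP : curvature_components W := components_curvature u Wc.
have tr0 i j : \sum_k W i k j k = 0 := weyl_tracefree RP ou i j.
have [[W1212 W1313 _] [[W1323 W1223 _] [W1213 W1214 W1314]]] :=
  weyl_eigenframe ou D.
have solve (a w : K) : a != 0 -> a * w = 0 -> w = 0.
  by move=> a0 /eqP; rewrite mulf_eq0 (negPf a0) => /eqP.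
have val : (W i1 i2 i1 i2 = - s / 12) * (W i1 i3 i1 i3 = - s / 12).
  have v12 : W i1 i2 i1 i2 + s / 12 = 0.
    by apply: solve W1212; rewrite !(tnth_nth 0) /=; lra.
  have v13 : W i1 i3 i1 i3 + s / 12 = 0.
    by apply: solve W1313; rewrite !(tnth_nth 0) /=; lra.
  by split; lra.
have val0 : (W i1 i2 i1 i3 = 0) * (W i1 i2 i1 i4 = 0) * (W i1 i2 i2 i3 = 0) *
    (W i1 i2 i2 i4 = 0) * (W i1 i3 i1 i4 = 0) * (W i1 i3 i2 i3 = 0).
  do !split=> //; [apply: solve W1213|apply: solve W1214|apply: solve W1223|
    apply: solve W1314|apply: solve W1323]; rewrite !(tnth_nth 0) /=; lra.
have W_biv v w : bivector (fun x y => weyl R x y v w).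
  split=> [x|x y]; first exact: curvature_lin2.
  exact: curvature_skew12.
have comb_biv a b v w v' w' :
    bivector (fun x y : T => a * wedge v w x y + b * wedge v' w' x y).
  have [l1 s1] := bivector_wedge v w; have [l2 s2] := bivector_wedge v' w'.
  by split=> [x k y z|x y]; [rewrite l1 l2; ring|rewrite s1 s2; ring].
have formE (k l : 'I_4) (a b : K) v w v' w' :
   (forall i j : 'I_4, (i < j)%N -> W i j k l =
     a * wedge v w (u i) (u j) + b * wedge v' w' (u i) (u j)) ->
   forall x y, weyl R x y (u k) (u l) = a * wedge v w x y + b * wedge v' w' x y.
  move=> H; apply: (bilinear_skew_ext (u := u)) => //; exact: H.
move=> x y; split; split; rewrite -?mulNr; apply: formE;
  do 2!apply: I4_ind => //; move=> _; rewrite ?(wedge_frame _ _ _ _ ou) /=.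
all: rewrite ?(canonical12 WP, canonical34 WP) ?(canonical_pairs WP).
all: rewrite ?(weyl_canonical WP tr0) ?val ?val0.
all: rewrite -?/(W i1 i3 i4 i2) ?(canonical34 WP) /W ?(canonical_bianchi WP).
all: by field.
Qed.

(** If no [m_1 + m_j] were zero, then [weyl_eigenframe] would give
[W_1j1j = - s/12] for all [j], and trace-freeness [s = 0]. Since the [m_i] are
sorted with sum 0, [m_1 + m_2 = 0] makes them all vanish, and [m_1 + m_3 = 0]
makes [m_1 = m_2] and [m_3 = m_4]. *)
Lemma einstein_eigenvalues_opposite u m :
  s != 0 -> ~ einstein R -> ~ two_double_eigenvalues e ->
  orthonormal_basis u -> diagonalizes e u m ->
  (forall i j : 'I_4, (i < j)%N -> m i <= m j) ->
  [/\ m i1 = - m i4, m i2 = - m i3, m i3 < m i4 & 0 <= m i3].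
Proof.
move=> s0 nE nD ou D srt.
have em := (diagonalizes_einsteinP RP _ ou).1 D.
have m0 : m i1 + m i2 + m i3 + m i4 = 0.
  by have := eigenvalues_sum0 RP ou em; rewrite sum_I4.
have m12 := srt i1 i2 isT; have m23 := srt i2 i3 isT; have m34 := srt i3 i4 isT.
have nz : m i1 < m i4.
  rewrite lt_neqAle; apply/andP; split; last by lra.
  apply/eqP => m14; apply: nE => x y.
  apply: (bilinear_ext (u := u) (einstein_bilinear RP) (B' := fun _ _ => 0)) => //.
    by split=> z a v w; rewrite mulr0 addr0.
  move=> i j; rewrite em; suff -> : m i = 0 by rewrite mul0r.
  by move: i; apply: I4_ind; lra.
have ndouble : ~ (m i1 = m i2 /\ m i3 = m i4).
  case=> e12 e34; apply: nD; exists (m i1), (m i4); split.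
  - by rewrite lt_eqF.
  - rewrite (multiplicity_diagonal _ ou D) -sum1_card big_mkcond sum_I4 !inE e34 -e12.
    by rewrite eqxx gt_eqF.
  - rewrite (multiplicity_diagonal _ ou D) -sum1_card big_mkcond sum_I4 !inE e34 -e12.
    by rewrite eqxx lt_eqF.
have m14 : m i1 + m i4 = 0.
  have [[/eqP h12 /eqP h13 /eqP h14] _] := weyl_eigenframe ou D.
  move: h12 h13 h14; rewrite !mulf_eq0 => /orP[/eqP|/eqP w12].
    by move=> *; lra.
  move=> /orP[/eqP m13|/eqP w13].
    by case: ndouble; split; lra.
  move=> /orP[/eqP //|/eqP w14]; case/eqP: s0.
  have WP := components_curvature u (weyl_curvature RP).
  have := weyl_tracefree RP ou i1 i1; rewrite sum_I4 (component_diag12 WP).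
  by lra.
have m34lt : m i3 < m i4.
  rewrite lt_neqAle m34 andbT; apply/eqP => e34; apply: ndouble; split=> //; lra.
by split; lra.
Qed.

Lemma exists_prescribed_form :
  s != 0 -> ~ einstein R -> ~ two_double_eigenvalues e ->
  exists (u : 'I_4 -> T) (lam mu c2 c3 c4 : K),
    positive_orthonormal_basis u /\ c2 + c3 + c4 = 0 /\ mu < lam /\ 0 <= mu /\
    prescribed_form R u s lam mu c2 c3 c4.
Proof.
move=> s0 nE nD.
have [u ou [off srt]] :=
  exists_sorted_eigenframe (einstein_bilinear RP) (einsteinC RP).
pose m i := e (u i) (u i).
have D : diagonalizes e u m.
  apply/(diagonalizes_einsteinP RP _ ou) => i j.
  by have [->|/off ->] := eqVneq i j; rewrite ?mulr1 ?mulr0.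
have [m1 m2 m34 m3] := einstein_eigenvalues_opposite s0 nE nD ou D srt.
have Wb (v : 'I_4 -> T) : bilinear_tensor (fun x y => weyl R (v i1) x (v i4) y).
  by split=> z; [apply: curvature_lin2|apply: curvature_lin4]; apply: weyl_curvature.
have [v [ov Dv W0]] : exists v, [/\ orthonormal_basis v, diagonalizes e v m &
    weyl R (v i1) (v i2) (v i4) (v i2) = 0].
  (* The frame needs to be rotated only if [e] has a two-dimensional kernel. *)
  have [m30|m30] := eqVneq (m i3) 0; last first.
    exists u; split=> //.
    have [_ [[_ _ /eqP]]] := weyl_eigenframe ou D.
    rewrite mulf_eq0 => /orP[/eqP h|/eqP W0 _]; first by case/eqP: m30; lra.
    by rewrite (curvature_skew34 (weyl_curvature RP)) W0 oppr0.
  have WP := components_curvature u (weyl_curvature RP).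
  have [|c [k [ck iso]]] := exists_isotropic (x := u i2) (y := u i3) (Wb u).
    have := weyl_tracefree RP ou i1 i4.
    by rewrite sum_I4 (component_diag12 WP) (component_diag34 WP); lra.
  exists (rotate i2 i3 c k u); split.
  - exact: rotate_orthonormal.
  - by apply: diagonalizes_rotate => //; rewrite m2 m30 oppr0.
  - by rewrite rotateE // !rotateN.
have [b pv] := exists_flip_positive ov.
exists (flip b v), (m i4), (m i3).
do 3!eexists; split; first exact: pv.
split; last (split; [exact: m34|split; [exact: m3|]]); last first.
  apply: prescribed_formP => //.
    have -> : tnth [tuple - m i4; - m i3; m i3; m i4] = m.
      by apply/funext; apply: I4_ind; rewrite (tnth_nth 0).
    exact: diagonalizes_flip.
  rewrite /flip /= andbF !scale1r (curvature_skew34 (weyl_curvature RP)).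
  rewrite (scalar_scale _ _ (curvature_lin1 (weyl_curvature RP) _ _ _)) W0.
  by rewrite mulr0 oppr0.
have WP := components_curvature (flip b v) (weyl_curvature RP).
by rewrite (canonical_bianchi WP) (canonical34 WP); ring.
Qed.

End Converse.

Theorem theorem1p4 (K : realType) (T : oriented_euclidean4 K) :
  (forall (u : 'I_4 -> T) (s lam mu c2 c3 c4 : K) (R : tensor4 T),
     positive_orthonormal_basis u ->
     c2 + c3 + c4 = 0 -> mu < lam -> 0 <= mu ->
     curvature_tensor R ->
     scalar_curvature R = s ->
     prescribed_form R u s lam mu c2 c3 c4 ->
     let W i j k l := weyl R (u i) (u j) (u k) (u l) in
     (* (a) *)
     weakly_einstein R /\
     (* (b) *)
     ((W i1 i2 i1 i2, W i1 i3 i1 i3, W i1 i4 i1 i4) =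
        (W i3 i4 i3 i4, W i2 i4 i2 i4, W i2 i3 i2 i3) /\
      (W i3 i4 i3 i4, W i2 i4 i2 i4, W i2 i3 i2 i3) =
        (- s / 12, - s / 12, s / 6) /\
      (W i1 i2 i3 i4, W i1 i3 i4 i2, W i1 i4 i2 i3) = (c2, c3, c4) /\
      forall i j k l : 'I_4, W i j k l <> 0 ->
        exists2 q : quad, q \in listed_components & alg_related q (i, j, k, l)))
  /\
  (* (c) *)
  (forall R : tensor4 T,
     curvature_tensor R -> ~ einstein R -> weakly_einstein R ->
     scalar_curvature R <> 0 ->
     ~ two_double_eigenvalues (einstein_tensor R) ->
     exists (u : 'I_4 -> T) (lam mu c2 c3 c4 : K),
       positive_orthonormal_basis u /\
       c2 + c3 + c4 = 0 /\ mu < lam /\ 0 <= mu /\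
       prescribed_form R u (scalar_curvature R) lam mu c2 c3 c4).
Proof.
split=> [u s lam mu c2 c3 c4 R pu c0 mulam mu0 RP sR pf W|R RP nE wR /eqP s0 nD].
  split; first exact: prescribed_weakly_einstein RP pu sR pf.
  have E := weyl_componentE RP pu pf.
  have WP := components_curvature u (weyl_curvature RP).
  split; first by rewrite /W !E.
  split; first by rewrite /W !E.
  split; last exact: weyl_component_listed RP pu pf.
  by rewrite /W (canonical34 WP) !E opprK.
exact: exists_prescribed_form.
Qed.
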